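(* Let $1\le k\le l$ and $d\ge1$ be natural numbers. Suppose that the following assertion is true: for every smooth map $\Omega\colon S^{d-1}\to G(l,k)$ with $\bigcap_{\zeta\in S^{d-1}}\Omega(\zeta)=\{0\}$ and every $\alpha\in(0,d)$ the operator $\mathrm{I}_\alpha$ maps $W_1^\Omega$ boundedly to $\dot B^{0,1}_{\frac{d}{d-\alpha},1}$. Then for every such $\Omega$ and every $\alpha\in(0,d)$ the operator $\mathrm{I}_\alpha$ also maps $\mathrm{BV}^\Omega$ boundedly to $\dot B^{0,1}_{\frac{d}{d-\alpha},1}$; that is, there is a constant $C$ with $$\|\mathrm{I}_\alpha[\mu]\|_{\dot B^{0,1}_{\frac{d}{d-\alpha},1}}\le C\|\mu\|_{\boldsymbol{\mathrm{M}}(\mathbb{R}^d,\mathbb{C}^l)}\qquad\text{for all }\mu\in\mathrm{BV}^\Omega .$$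
   Context: $G(l,k)$ is the complex Grassmannian of $k$-dimensional complex linear subspaces of $\mathbb{C}^l$; $S^{d-1}$ is the unit sphere of $\mathbb{R}^d$; $|\cdot|$ is the Euclidean norm. $\boldsymbol{\mathrm{M}}(\mathbb{R}^d,\mathbb{C}^l)$ is the space of $\mathbb{C}^l$-valued $\sigma$-additive Borel set functions (charges) of finite variation with the total variation norm. Fourier transforms: $\hat f(\xi)=\int_{\mathbb{R}^d} f(x)e^{-2\pi i\langle\xi,x\rangle}dx$, $\hat\mu(\xi)=\int_{\mathbb{R}^d} e^{-2\pi i\langle\xi,x\rangle}d\mu(x)$. $W_1^\Omega=\{f\in L_1(\mathbb{R}^d,\mathbb{C}^l):\ \hat f(\xi)\in\Omega(\xi/|\xi|)\ \forall\xi\ne0\}$ with the $L_1$ norm, and $\mathrm{BV}^\Omega=\{\mu\in\boldsymbol{\mathrm{M}}(\mathbb{R}^d,\mathbb{C}^l):\ \hat\mu(\xi)\in\Omega(\xi/|\xi|)\ \forall\xi\neq0\}$ with the norm of $\boldsymbol{\mathrm{M}}$. The Riesz potential is $\mathrm{I}_\alpha[\mu]=\mathcal{F}^{-1}[|\cdot|^{-\alpha}\hat\mu]$ (coordinatewise). Lorentz norm: $\|h\|_{L_{p,1}}=p\int_0^\infty |\{x\in\mathbb{R}^d: |h(x)|\ge t\}|^{1/p}\,dt$ (Lebesgue measure of sets). Besov--Lorentz norm: fix $A>1$ and a Schwartz function $\psi$ on $\mathbb{R}^d$ whose Fourier transform is compactly supported and equals $1$ near the origin; put $\psi_k(x)=A^{dk}\psi(A^kx)$;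 then $\|g\|_{\dot B^{0,1}_{p,1}}=\sum_{k\in\mathbb{Z}}\|g*(\psi_k-\psi_{k-1})\|_{L_{p,1}}$. *)

(* Defs.v *)
From HB Require Import structures.
From mathcomp Require Import all_boot all_order all_algebra.
From mathcomp Require Import complex.
From mathcomp Require Import all_classical all_reals all_analysis measurable_realfun.

Set Implicit Arguments.
Unset Strict Implicit.
Unset Printing Implicit Defensive.

Import Order.TTheory GRing.Theory Num.Theory.
Import numFieldNormedType.Exports.

Local Open Scope classical_set_scope.
Local Open Scope ring_scope.
Local Open Scope complex_scope.

(* R^n is 'rV[R]_n; its library norm is the sup norm, whence enorm below.
   Its measurable sets are the Borel sets. *)
Section borel_rV.
Context (R : realType) (n : nat).

Definition rV_borel : set (set 'rV[R]_n) := <<s @open 'rV[R]_n >>.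

Let rV_borel0 : rV_borel set0.
Proof. exact: sigma_algebra0. Qed.

Let rV_borelC A : rV_borel A -> rV_borel (~` A).
Proof. exact: sigma_algebraC. Qed.

Let rV_borelU (F : (set 'rV[R]_n)^nat) :
  (forall i, rV_borel (F i)) -> rV_borel (\bigcup_i F i).
Proof. exact: sigma_algebra_bigcup. Qed.

HB.instance Definition _ := @isMeasurable.Build (sigma_display (@open 'rV[R]_n))
  'rV[R]_n rV_borel rV_borel0 rV_borelC rV_borelU.

End borel_rV.

Section borel_rV_lemmas.
Context (R : realType).

Lemma open_measurable_rV n (U : set 'rV[R]_n) : open U -> measurable U.
Proof. exact: sub_sigma_algebra. Qed.

Lemma measurable_coord n (j : 'I_n) :
  measurable_fun [set: 'rV[R]_n] (fun x : 'rV[R]_n => x 0 j).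
Proof.
apply: (measurability _ (RGenOpens.measurableE R)).
move=> _ [_ [a [b ->]] <-]; rewrite setTI; apply: open_measurable_rV.
by apply: open_comp; [move=> x _; exact: coord_continuous|exact: interval_open].
Qed.

Lemma measurable_rV d (T : measurableType d) n (f : T -> 'rV[R]_n) :
  (forall j, measurable_fun [set: T] (fun t => f t 0 j)) ->
  measurable_fun [set: T] f.
Proof.
move=> mf; apply: (measurability (@open 'rV[R]_n)) => //.
move=> _ [U oU <-]; rewrite setTI.
pose c (p : 'rV[rat]_n * nat) : 'rV[R]_n := map_mx ratr p.1.
pose B p : set 'rV[R]_n := ball (c p) p.2.+1%:R^-1.
rewrite (_ : f @^-1` U =
    \bigcup_p (if `[< B p `<=` U >] then f @^-1` B p else set0)); last first.
  apply/seteqP; split => t /=; last first.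
    by move=> [p _]; case: asboolP => // + Bt; exact.
  move=> Uft; have : nbhs (f t) U by exact: open_nbhs_nbhs.
  move=> /nbhs_ballP[_/posnumP[e] feU].
  have [|N] := @ltr_add_invr R 0 (e%:num / 2) _; first by [].
  rewrite add0r => Ne.
  have N0 : (0 : R) < N.+1%:R^-1 by [].
  have /choice[q hq] : forall j, exists q : rat,
      ball (f t 0 j) N.+1%:R^-1 (ratr q : R).
    move=> j; have /rat_in_itvoo[q] :
      f t 0 j - N.+1%:R^-1 < f t 0 j + N.+1%:R^-1.
      by rewrite ltrD2l gtrN.
    by exists q; rewrite -[ball _ _ _]/(ball_ _ _ _ _) /= ltr_distlC.
  pose p : 'rV[rat]_n * nat := (\row_j q j, N).
  have Bft : B p (f t).
    by split => // i j; rewrite !mxE !ord1; apply: ball_sym; exact: hq.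
  exists p => //; case: asboolP => // -[] y By; apply: feU.
  rewrite [e%:num]splitr; apply: (@ball_triangle _ _ (c p)).
    by apply: (le_ball (ltW Ne)); exact: ball_sym.
  by apply: (le_ball (ltW Ne)).
apply: countable_bigcupT_measurable; first exact: countableP.
move=> p; case: ifP => // _.
rewrite (_ : _ @^-1` _ =
    \bigcap_(j in [set: 'I_n]) (fun t => f t 0 j) @^-1`
      (ball (c p 0 j) p.2.+1%:R^-1)); last first.
  apply/seteqP; split => t /=; first by move=> [_ h] j _; exact: h.
  by move=> h; split => // i j; rewrite ord1; exact: h.
apply: fin_bigcap_measurable => // j _; rewrite -[X in measurable X]setTI.
by apply: mf => //; apply: open_measurable; exact: ball_open.
Qed.

End borel_rV_lemmas.

Section lebesgue_rV.
Context (R : realType).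

Definition rV_cons n (p : measurableTypeR R * 'rV[R]_n) : 'rV[R]_n.+1 :=
  \row_i (if unlift ord0 i is Some j then p.2 0 j else p.1).

Lemma measurable_rV_cons n : measurable_fun [set: measurableTypeR R * 'rV[R]_n] (@rV_cons n).
Proof.
apply: measurable_rV => i; under eq_fun do rewrite mxE.
case: (unliftP ord0 i) => [j|] _; last exact: measurable_fst.
exact: (measurableT_comp (measurable_coord j) measurable_snd).
Qed.

Definition rV_uncons n (x : 'rV[R]_n.+1) : measurableTypeR R * 'rV[R]_n :=
  (x 0 ord0, \row_j x 0 (lift ord0 j)).

Lemma measurable_rV_uncons n : measurable_fun [set: 'rV[R]_n.+1] (@rV_uncons n).
Proof.
apply/measurable_fun_pair; first exact: measurable_coord.
apply: measurable_rV => i; under eq_fun do rewrite mxE.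
exact: measurable_coord.
Qed.

Lemma rV_consK n : cancel (@rV_cons n) (@rV_uncons n).
Proof.
move=> [x y]; congr pair; first by rewrite mxE unlift_none.
by apply/rowP => j; rewrite !mxE liftK.
Qed.

Lemma rV_unconsK n : cancel (@rV_uncons n) (@rV_cons n).
Proof.
move=> x; apply/rowP => i; rewrite mxE.
by case: unliftP => [j ->|->] /=; rewrite ?mxE.
Qed.

Section step.
Variables (n : nat) (m1 : {sigma_finite_measure set (measurableTypeR R) -> \bar R})
  (m : {sigma_finite_measure set 'rV[R]_n -> \bar R}).

Definition rV_cons_measure : set 'rV[R]_n.+1 -> \bar R :=
  pushforward (m1 \x m)%E (@rV_cons n).

Let step0 : rV_cons_measure set0 = 0%E.
Proof. by rewrite /rV_cons_measure /pushforward preimage_set0 measure0. Qed.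

Let step_ge0 A : (0 <= rV_cons_measure A)%E.
Proof. by rewrite /rV_cons_measure /pushforward measure_ge0. Qed.

Let measurable_preimage_cons (A : set 'rV[R]_n.+1) :
  measurable A -> measurable (@rV_cons n @^-1` A).
Proof.
by move=> mA; rewrite -[X in measurable X]setTI; exact: measurable_rV_cons.
Qed.

Let step_sigma_additive : semi_sigma_additive rV_cons_measure.
Proof.
move=> F mF tF mUF; rewrite /rV_cons_measure /pushforward preimage_bigcup.
apply: measure_semi_sigma_additive.
- by move=> i; exact: measurable_preimage_cons.
- apply/trivIsetP => /= i j _ _ ij; rewrite -preimage_setI.
  by move/trivIsetP : tF => /(_ _ _ _ _ ij) ->//; rewrite preimage_set0.
- by rewrite -preimage_bigcup; exact: measurable_preimage_cons.
Qed.

HB.instance Definition _ := isMeasure.Build _ _ _ rV_cons_measure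
  step0 step_ge0 step_sigma_additive.

Let step_sigma_finite : sigma_finite [set: 'rV[R]_n.+1] rV_cons_measure.
Proof.
have /sigma_finiteP[F [FT ndF Foo]] := sigma_finiteT m1.
have /sigma_finiteP[G [GT ndG Goo]] := sigma_finiteT m.
exists (fun i => @rV_uncons n @^-1` (F i `*` G i)).
  apply/esym; rewrite -subTset => x _ /=.
  have : [set: R] (rV_uncons x).1 by [].
  have : [set: 'rV[R]_n] (rV_uncons x).2 by [].
  rewrite FT GT => -[j _ Gj] [i _ Fi]; exists (maxn i j) => //; split => /=.
    by move: Fi; exact/subsetPset/ndF/leq_maxl.
  by move: Gj; exact/subsetPset/ndG/leq_maxr.
move=> i; have [mF Fi] := Foo i; have [mG Gi] := Goo i; split.
  rewrite -[X in measurable X]setTI; apply: measurable_rV_uncons => //.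
  exact: measurableX.
rewrite /rV_cons_measure /pushforward -comp_preimage.
rewrite (_ : _ \o _ = id); last by apply/funext => x /=; rewrite rV_consK.
by rewrite preimage_id product_measure1E// lte_mul_pinfty// ge0_fin_numE.
Qed.

HB.instance Definition _ := Measure_isSigmaFinite.Build _ _ _ rV_cons_measure
  step_sigma_finite.

End step.

(* Lebesgue measure on R^n, as an iterated product of the one on R; it is pinned
   down by its values on boxes (lebesgue_rV_box). *)
Fixpoint lebesgue_rV n : {sigma_finite_measure set 'rV[R]_n -> \bar R} :=
  match n with
  | 0 => \d_(0 : 'rV[R]_0)
  | n'.+1 => rV_cons_measure (@lebesgue_measure R) (lebesgue_rV n')
  end.

Lemma lebesgue_rV_box n (a b : 'rV[R]_n) : (forall j, a 0 j <= b 0 j) ->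
  lebesgue_rV n [set x | forall j, x 0 j \in `[a 0 j, b 0 j]] =
  (\prod_j (b 0 j - a 0 j))%:E.
Proof.
elim: n a b => [|n IH] a b ab.
  by rewrite big_ord0 /= diracE mem_set//= => -[].
pose a' : 'rV[R]_n := \row_j a 0 (lift ord0 j).
pose b' : 'rV[R]_n := \row_j b 0 (lift ord0 j).
pose I n' (c d : 'rV[R]_n') :=
  [set x : 'rV[R]_n' | forall j, x 0 j \in `[c 0 j, d 0 j]].
have consI : @rV_cons n @^-1` I _ a b = `[a 0 ord0, b 0 ord0] `*` I _ a' b'.
  apply/seteqP; split => [[x y] /= h|[x y] /= [h1 h2] j].
    split; first by have := h ord0; rewrite mxE unlift_none.
    by move=> j; have := h (lift ord0 j); rewrite !mxE liftK.
  by rewrite mxE; case: unliftP => [i|] ->//; have := h2 i; rewrite !mxE.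
have mI n' (c d : 'rV[R]_n') : measurable (I _ c d).
  rewrite (_ : I _ c d = \bigcap_(j in [set: 'I_n'])
      (fun x : 'rV[R]_n' => x 0 j) @^-1` `[c 0 j, d 0 j]); last first.
    by apply/seteqP; split => x /= h j; [move=> _|]; exact: h.
  apply: fin_bigcap_measurable => // j _; rewrite -[X in measurable X]setTI.
  exact: measurable_coord.
transitivity (lebesgue_measure `[a 0%R ord0, b 0%R ord0] *
              lebesgue_rV n (I _ a' b'))%E.
  rewrite /= /rV_cons_measure /pushforward -/(I _ a b) consI.
  by apply: product_measure1E => //; exact: mI.
have -> : lebesgue_rV n (I _ a' b') = (\prod_j (b' 0 j - a' 0 j))%:E.
  by apply: IH => j; rewrite !mxE.
rewrite lebesgue_measure_itv/= lte_fin big_ord_recl; have := ab ord0.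
under eq_bigr do rewrite !mxE.
rewrite le_eqVlt => /predU1P[->|->]; last by rewrite EFinM EFinB.
by rewrite ltxx subrr mul0r mul0e.
Qed.

End lebesgue_rV.

Section euclidean.
Context {R : realType}.

Definition dotp n (x y : 'rV[R]_n) : R := \sum_j x 0 j * y 0 j.

Definition enorm n (x : 'rV[R]_n) : R := Num.sqrt (\sum_j x 0 j ^+ 2).

Definition sphere n : set 'rV[R]_n := [set x | enorm x = 1].

(* Euclidean norm on C^l. *)
Definition cnorm l (v : 'rV[R[i]]_l) : R :=
  Num.sqrt (\sum_j (complex.Re (v 0 j) ^+ 2 + complex.Im (v 0 j) ^+ 2)).

Definition cis (t : R) : R[i] := cos t +i* sin t.

End euclidean.
Arguments sphere : clear implicits.

Section smooth.
Context {R : realType} {n : nat}.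
Implicit Types (U : set 'rV[R]_n) (f : 'rV[R]_n -> R) (g : 'rV[R]_n -> R[i]).

Definition partial (s : seq 'I_n) f : 'rV[R]_n -> R :=
  foldr (fun i h => 'D_(delta_mx 0 i) h) f s.

(* C^oo on U: all iterated partial derivatives exist and are continuous on U. *)
Definition smooth_on U f := forall (s : seq 'I_n) (x : 'rV[R]_n), U x ->
  {for x, continuous (partial s f)} /\
  forall i : 'I_n, derivable (partial s f) x (delta_mx 0 i).

Definition csmooth_on U g :=
  smooth_on U (fun x => complex.Re (g x)) /\ smooth_on U (fun x => complex.Im (g x)).

Definition rapidly_decreasing f := forall (s : seq 'I_n) (N : nat),
  exists M : R, forall x, (1 + enorm x) ^+ N * `|partial s f x| <= M.

Definition schwartz g := [/\ csmooth_on setT g,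
  rapidly_decreasing (fun x => complex.Re (g x)) & rapidly_decreasing (fun x => complex.Im (g x))].

End smooth.

Section grassmannian.
Context {R : realType}.

Definition rowspan k l (B : 'M[R[i]]_(k, l)) : {vspace 'rV[R[i]]_l} :=
  <<[seq row i B | i <- enum 'I_k]>>%VS.

(* Omega is given on the whole of R^d, but only its values on the unit sphere are
   constrained or used. *)
Definition grassmann_valued d l k (Omega : 'rV[R]_d -> {vspace 'rV[R[i]]_l}) :=
  forall z, sphere R d z -> \dim (Omega z) = k.

(* Smoothness as a map from the sphere to G(l, k).  The standard charts of G(l, k)
   are indexed by k-subsets of coordinates, enumerated by f: the subspaces on
   which these coordinates are independent are the row spaces of the matrices B
   with colsub f B = 1%:M, and the other columns of B, which the subspace
   determines, are its chart coordinates.  As usual for a map defined on a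
   submanifold of R^d, a chart expression is smooth when it extends smoothly to an
   open subset of R^d. *)
Definition grassmann_smooth d l k (Omega : 'rV[R]_d -> {vspace 'rV[R[i]]_l}) :=
  forall z, sphere R d z ->
  exists (f : 'I_k -> 'I_l) (U : set 'rV[R]_d) (B : 'rV[R]_d -> 'M[R[i]]_(k, l)),
  [/\ open U, U z, forall i j, csmooth_on U (fun x => B x i j) &
      forall x, U x -> sphere R d x ->
        colsub f (B x) = 1%:M /\ Omega x = rowspan (B x)].

Definition trivial_intersection d l (Omega : 'rV[R]_d -> {vspace 'rV[R[i]]_l}) :=
  forall v, (forall z, sphere R d z -> v \in Omega z) -> v = 0.

End grassmannian.

Section complex_integral.
Context {R : realType} {dT : measure_display} {T : measurableType dT}.

Definition cintegral (mu : {measure set T -> \bar R}) (f : T -> R[i]) : R[i] :=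
  (\int[mu]_x complex.Re (f x)) +i* (\int[mu]_x complex.Im (f x)).

Lemma hahn_sets (nu : {charge set T -> \bar R}) :
  {PN : set T * set T | hahn_decomposition nu PN.1 PN.2}.
Proof.
apply: cid; have [P [N PN]] := Hahn_decomposition nu.
by exists (P, N).
Qed.

(* Integral against a signed charge, through its Jordan decomposition (which does not
   depend on the Hahn sets, cf. Hahn_decomposition_uniq). *)
Definition charge_integral (nu : {charge set T -> \bar R}) (f : T -> R) : R :=
  \int[jordan_pos (svalP (hahn_sets nu))]_x f x -
  \int[jordan_neg (svalP (hahn_sets nu))]_x f x.

Definition charge_cintegral (nu : {charge set T -> \bar R}) (f : T -> R[i]) : R[i] :=
  charge_integral nu (fun x => complex.Re (f x)) +i* charge_integral nu (fun x => complex.Im (f x)).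

(* C^l-valued charges, given by the real and imaginary parts of their coordinates. *)
Record vcharge l := VCharge {
  vcharge_re : 'I_l -> {charge set T -> \bar R} ;
  vcharge_im : 'I_l -> {charge set T -> \bar R} }.

Definition vcharge_val l (mu : vcharge l) (A : set T) : 'rV[R[i]]_l :=
  \row_j (fine (vcharge_re mu j A) +i* fine (vcharge_im mu j A)).

(* The norm of M(T, C^l). *)
Definition vcharge_variation l (mu : vcharge l) : \bar R := ereal_sup
  [set (\sum_(0 <= i <oo) (cnorm (vcharge_val mu (E i)))%:E)%E | E in
    [set E : (set T)^nat | [/\ forall i, measurable (E i), trivIset setT E &
                               \bigcup_i E i = setT]]].

Definition vcharge_integral l (mu : vcharge l) (f : T -> R[i]) : 'rV[R[i]]_l :=
  \row_j (charge_cintegral (vcharge_re mu j) f +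
          (0 +i* 1) * charge_cintegral (vcharge_im mu j) f).

End complex_integral.
Arguments vcharge R {dT} T l.

Section fourier.
Context {R : realType} {d : nat}.
Local Notation lambda := (lebesgue_rV R d).

Definition fourier (f : 'rV[R]_d -> R[i]) (xi : 'rV[R]_d) : R[i] :=
  cintegral lambda (fun x => cis (- (2 * pi * dotp xi x)) * f x).

Definition inverse_fourier (f : 'rV[R]_d -> R[i]) (x : 'rV[R]_d) : R[i] :=
  cintegral lambda (fun xi => cis (2 * pi * dotp xi x) * f xi).

Definition vfourier l (f : 'rV[R]_d -> 'rV[R[i]]_l) (xi : 'rV[R]_d) : 'rV[R[i]]_l :=
  \row_j fourier (fun x => f x 0 j) xi.

Definition charge_fourier l (mu : vcharge R 'rV[R]_d l) (xi : 'rV[R]_d) :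
    'rV[R[i]]_l :=
  vcharge_integral mu (fun x => cis (- (2 * pi * dotp xi x))).

(* C^l-valued tempered distributions, as functionals on test functions; only their
   values at Schwartz functions matter. *)
Definition vdistribution l := ('rV[R]_d -> R[i]) -> 'rV[R[i]]_l.

Definition distribution_of l (h : 'rV[R]_d -> 'rV[R[i]]_l) : vdistribution l :=
  fun phi => \row_j cintegral lambda (fun x => h x 0 j * phi x).

Definition distribution_inverse_fourier l (u : vdistribution l) : vdistribution l :=
  fun phi => u (inverse_fourier phi).

Definition distribution_conv l (u : vdistribution l) (eta : 'rV[R]_d -> R[i])
    (x : 'rV[R]_d) : 'rV[R[i]]_l :=
  u (fun y => eta (x - y)).

(* I_alpha[mu], where m is the Fourier transform of mu. *)
Definition riesz (alpha : R) l (m : 'rV[R]_d -> 'rV[R[i]]_l) : vdistribution l :=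
  distribution_inverse_fourier
    (distribution_of (fun xi => (enorm xi `^ (- alpha))%:C *: m xi)).

Definition lorentz_norm (p : R) l (h : 'rV[R]_d -> 'rV[R[i]]_l) : \bar R :=
  (p%:E * \int[lebesgue_measure]_(t in `]0%R, +oo[)
            (lambda [set x | t <= cnorm (h x)]%R `^ p^-1))%E.

Definition dilate (A : R) (psi : 'rV[R]_d -> R[i]) (k : int) (x : 'rV[R]_d) : R[i] :=
  (A ^ (d%:Z * k))%:C * psi (A ^ k *: x).

(* The norm of B^{0,1}_{p,1}. *)
Definition besov_lorentz_norm (A : R) (psi : 'rV[R]_d -> R[i]) (p : R) l
    (g : vdistribution l) : \bar R :=
  (\esum_(k in [set: int]) lorentz_norm p
    (distribution_conv g (fun x => dilate A psi k x - dilate A psi (k - 1) x)%R))%E.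

Definition besov_kernel (psi : 'rV[R]_d -> R[i]) :=
  [/\ schwartz psi,
      compact (closure [set xi | fourier psi xi != 0]) &
      \forall xi \near (0 : 'rV[R]_d), fourier psi xi = 1].

Definition L1 l : set ('rV[R]_d -> 'rV[R[i]]_l) := [set f | forall j,
  lambda.-integrable setT (fun x => (complex.Re (f x 0 j))%:E) /\
  lambda.-integrable setT (fun x => (complex.Im (f x 0 j))%:E)].

Definition L1_norm l (f : 'rV[R]_d -> 'rV[R[i]]_l) : \bar R :=
  (\int[lambda]_x (cnorm (f x))%:E)%E.

Definition W1_space l (Omega : 'rV[R]_d -> {vspace 'rV[R[i]]_l}) :
    set ('rV[R]_d -> 'rV[R[i]]_l) :=
  [set f | L1 f /\ forall xi, xi != 0 ->
             vfourier f xi \in Omega ((enorm xi)^-1 *: xi)].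

Definition BV_space l (Omega : 'rV[R]_d -> {vspace 'rV[R[i]]_l}) :
    set (vcharge R 'rV[R]_d l) :=
  [set mu | (vcharge_variation mu < +oo)%E /\ forall xi, xi != 0 ->
              charge_fourier mu xi \in Omega ((enorm xi)^-1 *: xi)].

End fourier.

(* Main.v *)
Require Import Defs.
From mathcomp Require Import all_boot all_order all_algebra.
From mathcomp Require Import complex.
From mathcomp Require Import all_classical all_reals all_analysis.
From mathcomp Require Import measurable_realfun.
From mathcomp Require Import ring lra.

Set Implicit Arguments.
Unset Strict Implicit.
Unset Printing Implicit Defensive.

Import Order.TTheory GRing.Theory Num.Theory.
Import numFieldNormedType.Exports.
Import complex.ComplexField.Normc.

Local Open Scope classical_set_scope.
Local Open Scope ring_scope.
Local Open Scope complex_scope.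

(** The estimate passes from W_1 to BV by mollification, in a way that keeps the
    Fourier constraint, does not increase the norm, and approximates every
    Littlewood-Paley piece of the potential uniformly on R^d.

    Let Q be the half-open cube of side 1/N at the origin and let f_N be the
    convolution of mu with the normalised indicator of Q, that is
    f_N(x) = N^d mu(x - Q).  Three facts are needed.

    - The Fourier transform of f_N at xi is w_N(xi) times that of mu, where the
      scalar w_N(xi) is the mean of exp(-2 i pi <xi, z>) over z in Q
      ([vfourier_mollify]).  As Omega(xi/|xi|) is a linear subspace, f_N belongs
      to W_1^Omega.
    - The L_1 norm of f_N is at most the total variation of mu
      ([L1_norm_mollify]): cutting R^d into the translates of Q, the norm becomes
      the mean over z in Q of the sums of |mu(z + v/N - Q)| over integer vectors
      v, and for each z the sets z + v/N - Q form a partition of R^d.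
    - The k-th Littlewood-Paley piece of I_alpha[mu] is the inverse Fourier
      transform of the product of the transform of mu, which is bounded, with a
      bounded multiplier supported in an annulus ([besov_multiplier_band]): the
      difference of two dilates of the transform of psi vanishes near the origin,
      where it cancels the singularity of |xi|^(-alpha), and outside a compact
      set.  On such a set w_N - 1 = O(1/N), so the pieces for f_N converge to the
      pieces for mu uniformly in x, at rate 1/N ([riesz_piece_approx]).

    It remains to see that the Besov-Lorentz norm is lower semicontinuous under
    such a convergence ([lorentz_sum_lsc]).  If |h| <= |h_N| + eps, then the
    superlevel set of h at height t + eps is contained in that of h_N at height
    t; hence the Lorentz integral of h restricted to t > eps is at most the whole
    Lorentz integral of h_N.  For finitely many k one N serves all pieces, the
    hypothesis bounds the sum for f_N by C times the variation of mu, and eps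
    tends to 0. *)

(** * Lebesgue measure on R^n: substitutions and product integrands *)

Section lebesgue_affine_1d.
Context {R : realType}.
Local Notation mu := (@lebesgue_measure R).

Lemma measurable_affine1 (c b : R) :
  measurable_fun [set: measurableTypeR R]
    (fun t : measurableTypeR R => c * t + b : measurableTypeR R).
Proof. by apply: measurable_funD => //; exact: mulrl_measurable. Qed.

Lemma lebesgue_measure_affine (c b : R) (A : set (measurableTypeR R)) : c != 0 ->
  measurable A ->
  (mu ((fun t : R => (c * t + b)%R) @^-1` A) * `|c|%:E = mu A)%E.
Proof.
move=> c0 mA.
have c1 : 0 < `|c| by rewrite normr_gt0.
have c1nn : 0 <= `|c| by [].
pose m := mscale (NngNum c1nn)
  (pushforward mu (fun t : measurableTypeR R => c * t + b : measurableTypeR R)).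
suff : mu A = m (measurable_affine1 c b) A by rewrite /m /mscale/= muleC => ->.
apply: lebesgue_measure_unique => // X /ocitvP[->|[[x y]/= xy ->]].
  by rewrite !measure0.
rewrite /m /mscale/= /pushforward.
have [cp|cn] := ltP 0 c.
  rewrite (_ : _ @^-1` _ = `](x - b) / c, (y - b) / c]%classic); last first.
    apply/seteqP; split => t /=; rewrite !in_itv/= ltr_pdivrMr// ler_pdivlMr//;
    by rewrite ltrBlDr lerBrDr mulrC.
  rewrite !lebesgue_measure_itv/= !lte_fin xy ltr_pM2r ?invr_gt0// ltrD2r xy.
  rewrite -!EFinB -EFinM; congr EFin.
  by rewrite gtr0_norm// -mulrBl mulrC divfK//; lra.
have {}cn : c < 0 by rewrite lt_neqAle c0.
rewrite (_ : _ @^-1` _ = `[(y - b) / c, (x - b) / c[%classic); last first.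
  apply/seteqP; split => t /=; rewrite !in_itv/= ltr_ndivlMr// ler_ndivrMr//;
  by rewrite ltrBlDr lerBrDr mulrC andbC.
rewrite !lebesgue_measure_itv/= !lte_fin xy ltr_nM2r ?invr_lt0// ltrD2r xy.
rewrite -!EFinB -EFinM; congr EFin.
by rewrite ltr0_norm// -mulrBl mulNr mulrC divfK//; lra.
Qed.

Lemma ge0_integral_affine1 (c b : R) (f : R -> \bar R) : c != 0 ->
  measurable_fun [set: measurableTypeR R] f -> (forall t, (0 <= f t)%E) ->
  (\int[mu]_t f (c * t + b)%R * `|c|%:E = \int[mu]_t f t)%E.
Proof.
move=> c0 mf f0.
have c1nn : 0 <= `|c| by [].
pose phi := (fun t : measurableTypeR R => c * t + b : measurableTypeR R).
have mphi := measurable_affine1 c b.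
rewrite muleC.
have -> : (\int[mu]_t f (c * t + b)%R = \int[pushforward mu phi]_t f t)%E.
  by rewrite (ge0_integral_pushforward mphi).
rewrite -(@ge0_integral_mscale _ _ _ _ _ _ (NngNum c1nn))//.
apply: eq_measure_integral => // A mA _.
by rewrite /= /mscale/= muleC; exact: lebesgue_measure_affine.
Qed.

End lebesgue_affine_1d.

Section lebesgue_rV_integral.
Context {R : realType}.
Local Notation mu := (@lebesgue_measure R).
Local Notation lambda := (lebesgue_rV R).

Lemma ge0_integral_rV_cons n (f : 'rV[R]_n.+1 -> \bar R) :
  measurable_fun setT f -> (forall x, (0 <= f x)%E) ->
  (\int[lambda n.+1]_x f x = \int[mu]_t \int[lambda n]_y f (rV_cons (t, y)))%E.
Proof.
move=> mf f0.
transitivity (\int[mu \x lambda n]_p (f \o @rV_cons R n) p)%E.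
  have <- := @ge0_integral_pushforward _ _ _ _ R _ (@measurable_rV_cons R n)
    (mu \x lambda n)%E setT f measurableT mf (fun x _ => f0 x).
  by apply: eq_measure_integral; first exact: measurable_rV_cons.
rewrite fubini_tonelli1//; last by move=> x; exact: f0.
exact: (measurableT_comp mf (@measurable_rV_cons R n)).
Qed.

Lemma measurable_rV_cons_section n (f : 'rV[R]_n.+1 -> \bar R) t :
  measurable_fun setT f -> measurable_fun setT (fun y => f (rV_cons (t, y))).
Proof.
move=> mf; apply: (measurableT_comp mf).
exact: (measurableT_comp (@measurable_rV_cons R n) (pair1_measurable t)).
Qed.

Lemma measurable_fun_integral_rV_cons n (f : 'rV[R]_n.+1 -> \bar R) :
  measurable_fun setT f -> (forall x, (0 <= f x)%E) ->
  measurable_fun [set: measurableTypeR R] (fun t => \int[lambda n]_y f (rV_cons (t, y)))%E.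
Proof.
move=> mf f0; apply: (measurable_fun_fubini_tonelli_F (f \o @rV_cons R n)).
  exact: (measurableT_comp mf (@measurable_rV_cons R n)).
by move=> x; exact: f0.
Qed.

Lemma measurable_affine_rV n (c : R) (b : 'rV[R]_n) :
  measurable_fun setT (fun x : 'rV[R]_n => c *: x + b).
Proof.
apply: measurable_rV => j; under eq_fun do rewrite !mxE.
apply: measurable_funD => //; apply: measurable_funM => //.
exact: measurable_coord.
Qed.

(** Translations, reflections and dilations at once: each of the three is used
    below.  Tonelli's theorem reduces the substitution to one coordinate at a
    time. *)
Lemma ge0_integral_affine n (c : R) (b : 'rV[R]_n) (f : 'rV[R]_n -> \bar R) :
  c != 0 -> measurable_fun setT f -> (forall x, (0 <= f x)%E) ->
  (\int[lambda n]_x f (c *: x + b)%R * (`|c| ^+ n)%:E = \int[lambda n]_x f x)%E.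
Proof.
move=> c0; elim: n b f => [|n IH] b f mf f0.
  rewrite expr0 mule1; apply: eq_integral => x _; congr f.
  by apply/rowP => -[].
have mfa : measurable_fun setT (fun x : 'rV[R]_n.+1 => f (c *: x + b)).
  exact: (measurableT_comp mf (measurable_affine_rV c b)).
rewrite !ge0_integral_rV_cons//.
rewrite exprSr EFinM muleA -(@ge0_integral_affine1 _ c (b 0 ord0)
  (fun t => \int[lambda n]_y f (rV_cons (t, y)))%E)//; last 2 first.
- exact: (measurable_fun_integral_rV_cons mf f0).
- by move=> t; apply: integral_ge0.
congr (_ * _)%E.
rewrite -ge0_integralZr//; last 2 first.
- exact: (measurable_fun_integral_rV_cons mfa (fun x => f0 _)).
- by move=> t _; apply: integral_ge0.
apply: eq_integral => t _.
rewrite -(IH (\row_j b 0 (lift ord0 j))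
  (fun y => f (rV_cons ((c * t + b 0 ord0)%R, y))))//.
  congr (_ * _)%E; apply: eq_integral => y _; congr f.
  apply/rowP => j; rewrite !mxE.
  by case: unliftP => [i ->|->] /=; rewrite ?mxE.
exact: measurable_rV_cons_section.
Qed.

(** Gives both the volume of a grid cell and the integrability of the weight that
    dominates Schwartz functions. *)
Lemma integral_rV_prod n (f : 'I_n -> R -> R) :
  (forall j, measurable_fun [set: measurableTypeR R] (f j)) -> (forall j t, 0 <= f j t) ->
  (\int[lambda n]_x (\prod_j f j (x 0 j))%:E = \prod_j \int[mu]_t (f j t)%:E)%E.
Proof.
have mF m (g : 'I_m -> R -> R) : (forall j, measurable_fun [set: measurableTypeR R] (g j)) ->
  measurable_fun setT (fun x : 'rV[R]_m => (\prod_j g j (x 0 j))%:E).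
  move=> mg; apply/measurable_EFinP; apply: measurable_prod => j _.
  exact: (measurableT_comp (mg j) (measurable_coord j)).
elim: n f => [|n IH] f mf f0.
  by rewrite /= integral_dirac// ?diracT ?mul1e ?big_ord0//; exact: mF.
rewrite ge0_integral_rV_cons//; [|exact: mF|by move=> x; rewrite lee_fin prodr_ge0].
rewrite big_ord_recl -(IH (fun j => f (lift ord0 j)))//.
set J := (\int[lambda n]_x _)%E.
have J0 : (0 <= J)%E by apply: integral_ge0 => y _; rewrite lee_fin prodr_ge0.
rewrite -ge0_integralZr//; last 2 first.
- exact/measurable_EFinP.
- by move=> t _; rewrite lee_fin.
apply: eq_integral => t _; rewrite /J -ge0_integralZl//; last 3 first.
- by apply: (mF n (fun j => f (lift ord0 j))).
- by move=> y _; rewrite lee_fin prodr_ge0.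
- by rewrite lee_fin.
apply: eq_integral => y _; rewrite -EFinM big_ord_recl mxE unlift_none.
by congr (_ * _)%:E; apply: eq_bigr => j _; rewrite mxE liftK.
Qed.

End lebesgue_rV_integral.

(** * Integration of complex-valued functions *)

Section complex_functions.
Context {R : realType} {dT : measure_display} {T : measurableType dT}.
Implicit Types (f g : T -> R[i]) (mu : {measure set T -> \bar R}).

Lemma cReD (x y : R[i]) : complex.Re (x + y) = complex.Re x + complex.Re y.
Proof. by case: x; case: y. Qed.

Lemma cImD (x y : R[i]) : complex.Im (x + y) = complex.Im x + complex.Im y.
Proof. by case: x; case: y. Qed.

Lemma cReN (x : R[i]) : complex.Re (- x) = - complex.Re x.
Proof. by case: x. Qed.

Lemma cImN (x : R[i]) : complex.Im (- x) = - complex.Im x.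
Proof. by case: x. Qed.

Lemma cReM (x y : R[i]) : complex.Re (x * y) =
  complex.Re x * complex.Re y - complex.Im x * complex.Im y.
Proof. by case: x; case: y. Qed.

Lemma cImM (x y : R[i]) : complex.Im (x * y) =
  complex.Re x * complex.Im y + complex.Im x * complex.Re y.
Proof. by case: x; case: y => *; rewrite /=. Qed.

Lemma normcE (x : R[i]) : normc x = Num.sqrt (complex.Re x ^+ 2 + complex.Im x ^+ 2).
Proof. by case: x. Qed.

Lemma normc_ge0 (x : R[i]) : 0 <= normc x.
Proof. by rewrite normcE. Qed.

Lemma normr_Re_le (x : R[i]) : `|complex.Re x| <= normc x.
Proof. by rewrite normcE -sqrtr_sqr ler_wsqrtr// lerDl sqr_ge0. Qed.

Lemma normr_Im_le (x : R[i]) : `|complex.Im x| <= normc x.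
Proof. by rewrite normcE -sqrtr_sqr ler_wsqrtr// lerDr sqr_ge0. Qed.

Lemma normc_le_ReIm (x : R[i]) : normc x <= `|complex.Re x| + `|complex.Im x|.
Proof.
rewrite normcE -(ger0_norm (addr_ge0 (normr_ge0 (complex.Re x)) (normr_ge0 (complex.Im x)))).
rewrite -sqrtr_sqr ler_wsqrtr// sqrrD !real_normK ?num_real// -addrA lerD2l.
by rewrite lerDr mulrn_wge0// mulr_ge0.
Qed.

Lemma normc_cis (t : R) : normc (cis t) = 1.
Proof. by rewrite /cis/= cos2Dsin2 sqrtr1. Qed.

Lemma cisD (s t : R) : cis (s + t) = cis s * cis t.
Proof.
rewrite /cis cosD sinD; apply/eqP; rewrite eq_complex/=.
by rewrite eqxx/= addrC.
Qed.

Definition cmeasurable f := measurable_fun setT (fun x => complex.Re (f x)) /\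
  measurable_fun setT (fun x => complex.Im (f x)).

Lemma cmeasurable_cst (c : R[i]) : cmeasurable (fun=> c).
Proof. by split; exact: measurable_cst. Qed.

Lemma cmeasurable_real (f : T -> R) : measurable_fun setT f ->
  cmeasurable (fun x => (f x)%:C).
Proof. by split => //=; exact: measurable_cst. Qed.

Lemma cmeasurable_cis (f : T -> R) : measurable_fun setT f ->
  cmeasurable (fun x => cis (f x)).
Proof.
move=> mf; split => /=; apply: measurableT_comp => //.
  by apply: continuous_measurable_fun; exact: continuous_cos.
by apply: continuous_measurable_fun; exact: continuous_sin.
Qed.

Lemma cmeasurableD f g : cmeasurable f -> cmeasurable g ->
  cmeasurable (fun x => f x + g x).
Proof.
move=> [f1 f2] [g1 g2]; split.
  by under eq_fun do rewrite cReD; exact: measurable_funD.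
by under eq_fun do rewrite cImD; exact: measurable_funD.
Qed.

Lemma cmeasurableN f : cmeasurable f -> cmeasurable (fun x => - f x).
Proof.
move=> [f1 f2]; split.
  by under eq_fun do rewrite cReN; exact: measurable_funN.
by under eq_fun do rewrite cImN; exact: measurable_funN.
Qed.

Lemma cmeasurableM f g : cmeasurable f -> cmeasurable g ->
  cmeasurable (fun x => f x * g x).
Proof.
move=> [f1 f2] [g1 g2]; split.
  by under eq_fun do rewrite cReM; apply: measurable_funB; exact: measurable_funM.
by under eq_fun do rewrite cImM; apply: measurable_funD; exact: measurable_funM.
Qed.

Lemma measurable_normc f : cmeasurable f -> measurable_fun setT (fun x => normc (f x)).
Proof.
move=> [f1 f2]; under eq_fun do rewrite normcE.
apply: (@measurableT_comp _ _ _ _ _ _ (@Num.sqrt R)).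
  by apply: continuous_measurable_fun; exact: sqrt_continuous.
by apply: measurable_funD; exact: measurable_funX.
Qed.

Definition cintegrable mu f :=
  mu.-integrable setT (fun x => (complex.Re (f x))%:E) /\
  mu.-integrable setT (fun x => (complex.Im (f x))%:E).

Lemma cintegrable_cmeasurable mu f : cintegrable mu f -> cmeasurable f.
Proof.
by move=> [f1 f2]; split; apply/measurable_EFinP;
  [exact: (measurable_int mu f1)|exact: (measurable_int mu f2)].
Qed.

Lemma le_cintegrable mu f (g : T -> R) : cmeasurable f ->
  (forall x, normc (f x) <= g x) -> mu.-integrable setT (EFin \o g) ->
  cintegrable mu f.
Proof.
move=> [f1 f2] fg ig; split; apply: (le_integrable measurableT _ _ ig);
  try (exact/measurable_EFinP); move=> x _ /=; rewrite lee_fin.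
- by rewrite (le_trans (normr_Re_le _))// (le_trans (fg x))// ler_norm.
- by rewrite (le_trans (normr_Im_le _))// (le_trans (fg x))// ler_norm.
Qed.

Lemma cintegrable_normc mu f : cintegrable mu f ->
  mu.-integrable setT (fun x => (normc (f x))%:E).
Proof.
move=> if_; have [i1 i2] := if_.
have mf := cintegrable_cmeasurable if_.
have i12 : mu.-integrable setT
    (EFin \o (fun x => `|complex.Re (f x)| + `|complex.Im (f x)|)).
  have := integrableD measurableT (integrable_norm i1)
    (integrable_norm i2).
  exact: (@eq_integrable _ _ _ _ _ measurableT).
apply: (le_integrable measurableT _ _ i12).
  exact/measurable_EFinP/measurable_normc.
move=> x _ /=; rewrite lee_fin ger0_norm ?normc_ge0//.
by rewrite (le_trans (normc_le_ReIm _))// ler_norm.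
Qed.

Lemma cintegrableM mu f g (M : R) : cmeasurable g -> (forall x, normc (g x) <= M) ->
  cintegrable mu f -> cintegrable mu (fun x => g x * f x).
Proof.
move=> mg gM if_; apply: (@le_cintegrable _ _ (fun x => M * normc (f x))).
- exact: cmeasurableM (cintegrable_cmeasurable if_).
- by move=> x; rewrite normcM ler_wpM2r// normc_ge0.
- apply: (@eq_integrable _ _ _ _ _ measurableT (fun x => M%:E * (normc (f x))%:E)%E).
    by move=> x _; rewrite /= EFinM.
  by apply: integrableZl => //; exact: cintegrable_normc.
Qed.

Lemma cintegrableD mu f g : cintegrable mu f -> cintegrable mu g ->
  cintegrable mu (fun x => f x + g x).
Proof.
move=> [f1 f2] [g1 g2]; split.
  apply: (eq_integrable measurableT _ _ _ (integrableD measurableT f1 g1)).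
  by move=> x _ /=; rewrite cReD.
apply: (eq_integrable measurableT _ _ _ (integrableD measurableT f2 g2)).
by move=> x _ /=; rewrite cImD.
Qed.

Lemma cintegrableZ mu f (c : R[i]) : cintegrable mu f ->
  cintegrable mu (fun x => c * f x).
Proof.
by apply: (@cintegrableM _ _ _ (normc c)) => //; exact: cmeasurable_cst.
Qed.

Lemma cintegrableB mu f g : cintegrable mu f -> cintegrable mu g ->
  cintegrable mu (fun x => f x - g x).
Proof.
move=> if_ ig; under [X in cintegrable _ X]eq_fun do rewrite -mulN1r.
by apply: cintegrableD => //; exact: cintegrableZ.
Qed.

Lemma eq_cintegral mu f g : f =1 g -> cintegral mu f = cintegral mu g.
Proof. by move=> /funext ->. Qed.

Lemma cintegralD mu f g : cintegrable mu f -> cintegrable mu g ->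
  cintegral mu (fun x => f x + g x) = cintegral mu f + cintegral mu g.
Proof.
move=> [f1 f2] [g1 g2]; rewrite /cintegral.
under eq_Rintegral do rewrite cReD.
under [X in _ +i* X]eq_Rintegral do rewrite cImD.
by rewrite !RintegralD.
Qed.

Lemma cintegralZ mu f (c : R[i]) : cintegrable mu f ->
  cintegral mu (fun x => c * f x) = c * cintegral mu f.
Proof.
move=> [f1 f2]; rewrite /cintegral.
have iZ (r : R) (h : T -> R) : mu.-integrable setT (fun x => (h x)%:E) ->
    mu.-integrable setT (EFin \o (fun x => r * h x)).
  move=> ih; apply: (eq_integrable measurableT _ _ _ (integrableZl measurableT r ih)).
  by move=> x _; rewrite /= EFinM.
under eq_Rintegral do rewrite cReM.
under [X in _ +i* X]eq_Rintegral do rewrite cImM.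
rewrite RintegralB//; [|exact: iZ|exact: iZ].
rewrite RintegralD//; [|exact: iZ|exact: iZ].
by rewrite !RintegralZl//; case: c.
Qed.

Lemma cintegralB mu f g : cintegrable mu f -> cintegrable mu g ->
  cintegral mu (fun x => f x - g x) = cintegral mu f - cintegral mu g.
Proof.
move=> if_ ig; under eq_cintegral do rewrite -mulN1r.
by rewrite cintegralD ?cintegralZ ?mulN1r//; exact: cintegrableZ.
Qed.

(** The factor 2 comes from bounding the real and the imaginary part separately. *)
Lemma normc_cintegral_le mu f (g : T -> R) : cmeasurable f ->
  (forall x, normc (f x) <= g x) -> mu.-integrable setT (EFin \o g) ->
  normc (cintegral mu f) <= 2 * \int[mu]_x g x.
Proof.
move=> mf fg ig; have [f1 f2] := le_cintegrable mf fg ig.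
have le1 (h : T -> R) : mu.-integrable setT (EFin \o h) -> (forall x, `|h x| <= g x) ->
    `|\int[mu]_x h x| <= \int[mu]_x g x.
  move=> ih hg; apply: (le_trans (le_normr_Rintegral measurableT ih)).
  by apply: le_Rintegral => //; exact: integrable_norm.
rewrite (le_trans (normc_le_ReIm _))//= mulr_natl mulr2n; apply: lerD.
  by apply: le1 => // x; exact: le_trans (normr_Re_le _) (fg x).
by apply: le1 => // x; exact: le_trans (normr_Im_le _) (fg x).
Qed.

End complex_functions.

Section parameter_integral.
Context {R : realType} {d1 d2 : measure_display} {T1 : measurableType d1}
  {T2 : measurableType d2}.

(** The positive and negative parts are measurable in x by Tonelli's theorem, and
    [fine] is measurable. *)
Lemma measurable_Rintegral_param (m2 : {sigma_finite_measure set T2 -> \bar R})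
    (f : T1 * T2 -> R) : measurable_fun setT f ->
  measurable_fun setT (fun x => \int[m2]_y f (x, y)).
Proof.
move=> mf; apply: measurableT_comp => //=.
have mF : measurable_fun setT (EFin \o f) by exact/measurable_EFinP.
rewrite [X in measurable_fun _ X](_ : _ = fun x =>
    (\int[m2]_y (EFin \o f)^\+ (x, y) - \int[m2]_y (EFin \o f)^\- (x, y))%E).
  apply: emeasurable_funB.
    by apply: measurable_fun_fubini_tonelli_F => //; exact: measurable_funepos.
  by apply: measurable_fun_fubini_tonelli_F => //; exact: measurable_funeneg.
apply/funext => x; rewrite [LHS]integralE.
by congr (_ - _)%E; apply: eq_integral => y _; rewrite ?funeposE ?funenegE.
Qed.

Lemma cmeasurable_cintegral_param (m2 : {sigma_finite_measure set T2 -> \bar R})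
    (f : T1 * T2 -> R[i]) : cmeasurable f ->
  cmeasurable (fun x => cintegral m2 (fun y => f (x, y))).
Proof.
move=> [f1 f2]; split => /=.
  exact: (measurable_Rintegral_param m2 f1).
exact: (measurable_Rintegral_param m2 f2).
Qed.

End parameter_integral.

(** * Substitutions in complex integrals, integrability of Schwartz functions *)

Section affine_change.
Context {R : realType} {n : nat}.
Local Notation lambda := (lebesgue_rV R n).

Lemma integrable_affine (c : R) (b : 'rV[R]_n) (f : 'rV[R]_n -> R) : c != 0 ->
  lambda.-integrable setT (EFin \o f) ->
  lambda.-integrable setT (EFin \o (fun x => f (c *: x + b))).
Proof.
move=> c0 /integrableP[mf fi]; apply/integrableP.
have mfa : measurable_fun setT (EFin \o (fun x => f (c *: x + b))).
  exact: (measurableT_comp mf (measurable_affine_rV c b)).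
split => //; move: fi.
rewrite -(@ge0_integral_affine _ _ c b (fun x => `|(EFin \o f) x|)%E)//; last first.
  exact: measurableT_comp.
rewrite -[X in (_ < X)%E -> _](@gt0_mulye R (`|c| ^+ n)%:E) ?lte_fin ?exprn_gt0 ?normr_gt0//.
by rewrite lte_pmul2r// ?lte_fin ?exprn_gt0 ?normr_gt0.
Qed.

Lemma Rintegral_affine (c : R) (b : 'rV[R]_n) (f : 'rV[R]_n -> R) : c != 0 ->
  lambda.-integrable setT (EFin \o f) ->
  \int[lambda]_x f (c *: x + b) * `|c| ^+ n = \int[lambda]_x f x.
Proof.
move=> c0 fi; have fai := integrable_affine b c0 fi.
have mf := measurable_int lambda fi.
have fin0 (g : 'rV[R]_n -> \bar R) : lambda.-integrable setT g ->
    (\int[lambda]_x g x)%E = (fine (\int[lambda]_x g x))%:E.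
  by move=> ig; rewrite fineK// integrable_fin_num.
apply: EFin_inj; rewrite EFinM /Rintegral -!fin0//.
rewrite integralE [RHS]integralE muleBl//; last exact: (integrable_add_def measurableT fai).
congr (_ - _)%E.
- rewrite -(@ge0_integral_affine _ _ c b ((fun y => (f y)%:E)^\+)%E)//; last exact: measurable_funepos.
  by congr (_ * _)%E; apply: eq_integral => x _; rewrite !funeposE.
- rewrite -(@ge0_integral_affine _ _ c b ((fun y => (f y)%:E)^\-)%E)//; last exact: measurable_funeneg.
  by congr (_ * _)%E; apply: eq_integral => x _; rewrite !funenegE.
Qed.

Lemma cintegrable_affine (c : R) (b : 'rV[R]_n) (f : 'rV[R]_n -> R[i]) : c != 0 ->
  cintegrable lambda f -> cintegrable lambda (fun x => f (c *: x + b)).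
Proof.
by move=> c0 [f1 f2]; split; [exact: (integrable_affine b c0 f1)|exact: (integrable_affine b c0 f2)].
Qed.

Lemma cintegral_affine (c : R) (b : 'rV[R]_n) (f : 'rV[R]_n -> R[i]) : c != 0 ->
  cintegrable lambda f ->
  (`|c| ^+ n)%:C * cintegral lambda (fun x => f (c *: x + b)) = cintegral lambda f.
Proof.
move=> c0 [f1 f2]; rewrite /cintegral -(Rintegral_affine b c0 f1) -(Rintegral_affine b c0 f2).
by apply/eqP; rewrite eq_complex/= !mul0r subr0 addr0 ![_ * _ ^+ _]mulrC !eqxx.
Qed.

End affine_change.

Section dotp.
Context {R : realType} {n : nat}.
Implicit Types x y z : 'rV[R]_n.

Lemma dotpC x y : dotp x y = dotp y x.
Proof. by apply: eq_bigr => j _; rewrite mulrC. Qed.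

Lemma dotpDr x y z : dotp x (y + z) = dotp x y + dotp x z.
Proof. by rewrite -big_split; apply: eq_bigr => j _; rewrite mxE mulrDr. Qed.

Lemma dotpZr (c : R) x y : dotp x (c *: y) = c * dotp x y.
Proof. by rewrite /dotp mulr_sumr; apply: eq_bigr => j _; rewrite mxE mulrCA. Qed.

Lemma dotpZl (c : R) x y : dotp (c *: x) y = c * dotp x y.
Proof. by rewrite dotpC dotpZr dotpC. Qed.

Lemma dotpNr x y : dotp x (- y) = - dotp x y.
Proof. by rewrite -scaleN1r dotpZr mulN1r. Qed.

Lemma measurable_dotp {dT} {T : measurableType dT} (f g : T -> 'rV[R]_n) :
  measurable_fun setT f -> measurable_fun setT g ->
  measurable_fun setT (fun t => dotp (f t) (g t)).
Proof.
move=> mf mg; apply: measurable_sum => j; apply: measurable_funM.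
  exact: (measurableT_comp (measurable_coord j) mf).
exact: (measurableT_comp (measurable_coord j) mg).
Qed.

Lemma measurable_enorm : measurable_fun setT (@enorm R n).
Proof.
apply: (@measurableT_comp _ _ _ _ _ _ (@Num.sqrt R)).
  by apply: continuous_measurable_fun; exact: sqrt_continuous.
apply: measurable_sum => j; apply: measurable_funX; exact: measurable_coord.
Qed.

Lemma continuous_measurable_rV (f : 'rV[R]_n -> R) : continuous f ->
  measurable_fun setT f.
Proof.
move=> cf; apply: (measurability _ (RGenOpens.measurableE R)).
move=> _ [_ [a [b ->]] <-]; rewrite setTI; apply: open_measurable_rV.
by apply: open_comp; [move=> x _; exact: cf|exact: interval_open].
Qed.

Lemma enorm_ge0 x : 0 <= enorm x.
Proof. exact: sqrtr_ge0. Qed.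

Lemma coord_le_enorm x j : `|x 0 j| <= enorm x.
Proof.
rewrite /enorm -sqrtr_sqr ler_wsqrtr// (bigD1 j)//= lerDl.
by apply: sumr_ge0 => i _; exact: sqr_ge0.
Qed.

End dotp.

Section schwartz_integrable.
Context {R : realType} {n : nat}.
Local Notation lambda := (lebesgue_rV R n).
Local Notation mu := (@lebesgue_measure R).

Lemma integral_oneDsqrV : (\int[mu]_t ((oneDsqr t)^-1)%:E = pi%:E)%E.
Proof.
rewrite ge0_symfun_integralT.
- rewrite -set_itvcy integral0y_oneDsqr -EFinM; congr EFin; lra.
- by move=> x; rewrite invr_ge0 (le_trans ler01)// oneDsqr_ge1.
- exact: continuous_oneDsqrV.
- by move=> x; rewrite /= /oneDsqr sqrrN.
Qed.

Lemma integrable_prod_oneDsqrV :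
  lambda.-integrable setT (EFin \o (fun x : 'rV[R]_n => \prod_j (oneDsqr (x 0 j))^-1)).
Proof.
have o0 (t : R) : 0 <= (oneDsqr t)^-1.
  by rewrite invr_ge0 (le_trans ler01)// oneDsqr_ge1.
have mo : measurable_fun [set: measurableTypeR R] (fun t : R => (oneDsqr t)^-1).
  by apply: continuous_measurable_fun; exact: continuous_oneDsqrV.
apply/integrableP; split.
  apply/measurable_EFinP; apply: measurable_prod => j _.
  exact: (measurableT_comp mo (measurable_coord j)).
under eq_integral.
  by move=> x _; rewrite /= ger0_norm ?prodr_ge0//; over.
rewrite (@integral_rV_prod _ _ (fun=> fun t => (oneDsqr t)^-1))//.
under eq_bigr do rewrite integral_oneDsqrV.
by rewrite prodEFin ltry.
Qed.

(** The power (1 + |x|)^(2n) dominates the product of the 1 + x_j^2, whose inverse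
    has a finite integral over R^n, equal to pi^n. *)
Lemma rapidly_decreasing_integrable (f : 'rV[R]_n -> R) : continuous f ->
  rapidly_decreasing f -> lambda.-integrable setT (EFin \o f).
Proof.
move=> cf rf; have [M HM] := rf [::] (2 * n)%N.
have := integrableZl measurableT M integrable_prod_oneDsqrV.
apply: le_integrable => //.
  by apply/measurable_EFinP; exact: continuous_measurable_rV.
move=> x _; rewrite /= lee_fin.
have e0 : 0 < (1 + enorm x) ^+ (2 * n).
  by rewrite exprn_gt0// ltr_wpDr// enorm_ge0.
have M0 : 0 <= M.
  by apply: le_trans (HM x); rewrite mulr_ge0// ltW.
have p0 : 0 < \prod_j oneDsqr (x 0 j).
  by apply: prodr_gt0 => j _; rewrite (lt_le_trans ltr01)// oneDsqr_ge1.
rewrite prodfV normrM (ger0_norm M0) normfV (gtr0_norm p0) ler_pdivlMr//.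
apply: le_trans (HM x); rewrite mulrC ler_wpM2r//.
rewrite exprM -[X in _ ^+ X]card_ord -prodr_const; apply: ler_prod => j _.
have -> /= : 0 <= oneDsqr (x 0 j) by rewrite (le_trans ler01)// oneDsqr_ge1.
have : `|x 0 j| ^+ 2 <= enorm x ^+ 2.
  by rewrite lerXn2r// ?nnegrE ?enorm_ge0// coord_le_enorm.
rewrite real_normK ?num_real// /oneDsqr => xj.
by have := enorm_ge0 x; nra.
Qed.

Lemma schwartz_cintegrable (g : 'rV[R]_n -> R[i]) : schwartz g -> cintegrable lambda g.
Proof.
by move=> [[s1 s2] r1 r2]; split; apply: rapidly_decreasing_integrable => // x;
  [have [] := s1 [::] x I|have [] := s2 [::] x I].
Qed.

End schwartz_integrable.

(** * Fourier transforms and Littlewood-Paley multipliers *)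

Local Arguments normc : simpl never.

Section fourier_facts.
Context {R : realType} {n : nat}.
Local Notation lambda := (lebesgue_rV R n).
Implicit Types (f g eta : 'rV[R]_n -> R[i]).

Lemma cmeasurable_cis_dotp {dT} {T : measurableType dT} (s : R) (f g : T -> 'rV[R]_n) :
  measurable_fun setT f -> measurable_fun setT g ->
  cmeasurable (fun t => cis (s * dotp (f t) (g t))).
Proof.
move=> mf mg; apply: cmeasurable_cis; apply: measurable_funM => //.
exact: measurable_dotp.
Qed.

Lemma cintegrable_cisM (s : R) (xi : 'rV[R]_n) f : cintegrable lambda f ->
  cintegrable lambda (fun x => cis (s * dotp xi x) * f x).
Proof.
move=> fi; apply: (@cintegrableM _ _ _ _ _ _ 1) => //.
  exact: cmeasurable_cis_dotp.
by move=> x; rewrite normc_cis.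
Qed.

Lemma fourierE f xi : fourier f xi =
  cintegral lambda (fun x => cis (- (2 * pi) * dotp xi x) * f x).
Proof. by apply: eq_cintegral => x; rewrite mulNr. Qed.

Lemma cmeasurable_fourier f : cmeasurable f -> cmeasurable (fourier f).
Proof.
move=> mf; pose F (p : 'rV[R]_n * 'rV[R]_n) := cis (- (2 * pi) * dotp p.1 p.2) * f p.2.
have -> : fourier f = fun xi => cintegral lambda (fun x => F (xi, x)).
  by apply/funext => xi; rewrite fourierE.
apply: (@cmeasurable_cintegral_param _ _ _ _ _ lambda F); apply: cmeasurableM.
  exact: cmeasurable_cis_dotp.
by case: mf => m1 m2; split; [exact: (measurableT_comp m1 measurable_snd)|
  exact: (measurableT_comp m2 measurable_snd)].
Qed.

Lemma normc_fourier_le f : cintegrable lambda f ->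
  forall xi, normc (fourier f xi) <= 2 * \int[lambda]_x normc (f x).
Proof.
move=> fi xi; rewrite fourierE; apply: normc_cintegral_le.
- exact: cintegrable_cmeasurable (cintegrable_cisM _ _ fi).
- by move=> x; rewrite normcM normc_cis mul1r.
- exact: cintegrable_normc.
Qed.

Lemma fourierB f g xi : cintegrable lambda f -> cintegrable lambda g ->
  fourier (fun x => f x - g x) xi = fourier f xi - fourier g xi.
Proof.
move=> fi gi; rewrite !fourierE -cintegralB; [|exact: cintegrable_cisM..].
by apply: eq_cintegral => x; rewrite mulrBr.
Qed.

(** The point x enters only through a unimodular factor; this is what makes the
    approximation of the potential uniform in x. *)
Lemma inverse_fourier_reflect eta x xi : cintegrable lambda eta ->
  inverse_fourier (fun y => eta (x - y)) xi =
  cis (2 * pi * dotp xi x) * fourier eta xi.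
Proof.
move=> ei; have n1 : (-1 : R) != 0 by rewrite oppr_eq0 oner_eq0.
rewrite fourierE -cintegralZ; last exact: cintegrable_cisM.
have gi : cintegrable lambda (fun y => cis (2 * pi * dotp xi y) * eta (x - y)).
  apply: cintegrable_cisM.
  have := cintegrable_affine x n1 ei; congr (cintegrable _ _).
  by apply/funext => y; rewrite scaleN1r addrC.
rewrite [LHS](_ : _ = cintegral lambda (fun y : 'rV[R]_n =>
  cis (2 * pi * dotp xi y) * eta (x - y))); last first.
  by apply: eq_cintegral => y; rewrite dotpC.
rewrite -(cintegral_affine x n1 gi).
rewrite normrN1 expr1n mul1r.
apply: eq_cintegral => y; rewrite mulrA -cisD scaleN1r opprD opprK addrCA subrr addr0.
by congr (cis _ * _); rewrite dotpDr dotpNr; ring.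
Qed.

Lemma cintegrable_dilate (A : R) psi (k : int) : 0 < A -> cintegrable lambda psi ->
  cintegrable lambda (dilate A psi k).
Proof.
move=> A0 ip; apply: cintegrableZ.
have := cintegrable_affine 0 (lt0r_neq0 (exprz_gt0 k A0)) ip.
by congr (cintegrable _ _); apply/funext => y; rewrite addr0.
Qed.

Lemma fourier_dilate (A : R) psi (k : int) xi : 0 < A -> cintegrable lambda psi ->
  fourier (dilate A psi k) xi = fourier psi (A ^ (- k) *: xi).
Proof.
move=> A0 ip; have Ak0 := exprz_gt0 k A0.
have ci := cintegrable_cisM (- (2 * pi)) (A ^ (- k) *: xi) ip.
rewrite !fourierE -(cintegral_affine 0 (lt0r_neq0 Ak0) ci).
have di : cintegrable lambda (fun x => cis (- (2 * pi) * dotp xi x) * psi (A ^ k *: x)).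
  apply: cintegrable_cisM.
  have := cintegrable_affine 0 (lt0r_neq0 Ak0) ip.
  by congr (cintegrable _ _); apply/funext => y; rewrite addr0.
have -> : `|A ^ k| ^+ n = A ^ (n%:Z * k).
  by rewrite gtr0_norm// exprnP exprz_exp mulrC.
rewrite -[LHS](_ : cintegral lambda (fun x => (A ^ (n%:Z * k))%:C *
   (cis (- (2 * pi) * dotp xi x) * psi (A ^ k *: x))) = _); last first.
  by apply: eq_cintegral => x; rewrite /dilate mulrCA.
rewrite cintegralZ//; congr (_ * _); apply: eq_cintegral => x.
rewrite addr0 dotpZl dotpZr; congr (cis (_ * _) * _).
by rewrite mulrA -expfzDr ?lt0r_neq0// addNr expr0z mul1r.
Qed.

End fourier_facts.

Section besov_multiplier.
Context {R : realType} {n : nat}.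
Local Notation lambda := (lebesgue_rV R n).
Implicit Types (psi : 'rV[R]_n -> R[i]) (xi : 'rV[R]_n).

Definition besov_piece (A : R) psi (k : int) (x : 'rV[R]_n) : R[i] :=
  dilate A psi k x - dilate A psi (k - 1) x.

(** The Fourier symbol of the k-th Littlewood-Paley piece of I_alpha. *)
Definition besov_multiplier (A : R) psi (alpha : R) (k : int) xi : R[i] :=
  (enorm xi `^ (- alpha))%:C * fourier (besov_piece A psi k) xi.

Definition cube (rho : R) : set 'rV[R]_n := [set x | forall j, x 0 j \in `[- rho, rho]].

Lemma measurable_cube rho : measurable (cube rho).
Proof.
rewrite (_ : cube rho = \bigcap_(j in [set: 'I_n])
    (fun x : 'rV[R]_n => x 0 j) @^-1` `[- rho, rho]); last first.
  by apply/seteqP; split => x /= h j; [move=> _|]; exact: h.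
apply: fin_bigcap_measurable => // j _; rewrite -[X in measurable X]setTI.
exact: measurable_coord.
Qed.

Lemma integrable_indic_cube rho : 0 <= rho ->
  lambda.-integrable setT (EFin \o \1_(cube rho)).
Proof.
move=> rho0; have mC := measurable_cube rho; apply/integrableP; split.
  exact/measurable_EFinP/measurable_indic.
under eq_integral do rewrite /= ger0_norm//.
rewrite integral_indic// setIT.
have -> : cube rho = [set x : 'rV[R]_n | forall j, x 0 j \in
    `[(const_mx (- rho) : 'rV[R]_n) 0 j, (const_mx rho : 'rV[R]_n) 0 j]].
  by apply/seteqP; split => x /= h j; have := h j; rewrite !mxE.
have bx := @lebesgue_rV_box R n (const_mx (- rho)) (const_mx rho).
apply: (@le_lt_trans _ _ (\prod_j ((const_mx rho : 'rV[R]_n) 0 j -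
    (const_mx (- rho) : 'rV[R]_n) 0 j))%:E); last exact: ltry.
by rewrite -bx// => j; rewrite !mxE; lra.
Qed.

Lemma norm_le_enorm (xi : 'rV[R]_n) : `|xi| <= enorm xi.
Proof.
rewrite [leLHS]/Num.Def.normr/= mx_normrE.
apply: bigmax_le => /=; first exact: enorm_ge0.
by move=> [i j] _ /=; rewrite ord1 coord_le_enorm.
Qed.

(** Near the origin both dilates of the transform of psi equal 1 and their
    difference cancels the singularity of |xi|^(-alpha); far from the origin both
    vanish. *)
Lemma besov_multiplier_band (A : R) psi alpha k : 1 < A -> 0 <= alpha ->
  besov_kernel psi ->
  cmeasurable (besov_multiplier A psi alpha k) /\
  exists B rho, [/\ 0 <= B, 0 <= rho & forall xi,
    normc (besov_multiplier A psi alpha k xi) <= B * \1_(cube rho) xi].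
Proof.
move=> A1 al0 [spsi cpsi npsi]; have A0 : 0 < A by rewrite (lt_trans ltr01).
have ip := schwartz_cintegrable spsi.
have mp : cmeasurable (fourier (besov_piece A psi k)).
  apply: cmeasurable_fourier; apply: (@cintegrable_cmeasurable _ _ _ lambda).
  by apply: cintegrableB; exact: cintegrable_dilate.
split.
  apply: cmeasurableM => //; apply: cmeasurable_real.
  apply: (measurableT_comp (measurable_powR (- alpha))).
  exact: measurable_enorm.
have thE xi : fourier (besov_piece A psi k) xi =
    fourier psi (A ^ (- k) *: xi) - fourier psi (A ^ (- (k - 1)) *: xi).
  rewrite /besov_piece fourierB; [|exact: cintegrable_dilate..].
  by rewrite !fourier_dilate.
pose b := 2 * \int[lambda]_x normc (psi x).
have b0 : 0 <= b.
  by rewrite mulr_ge0// Rintegral_ge0// => x _; exact: normc_ge0.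
have thb xi : normc (fourier (besov_piece A psi k) xi) <= b + b.
  rewrite thE (le_trans (le_normcD _ _))// normcN.
  by apply: lerD; exact: normc_fourier_le.
pose a1 := A ^ (- k); pose a2 := A ^ (- (k - 1)).
have a10 : 0 < a1 by exact: exprz_gt0.
have a20 : 0 < a2 by exact: exprz_gt0.
move: npsi => /nbhs_ballP[e /= e0 He].
have He' xi : `|xi| < e -> fourier psi xi = 1.
  by move=> xie; apply: He; rewrite -ball_normE/= sub0r normrN.
have [M M0 HM] : exists2 M, 0 <= M & forall xi, M < `|xi| -> fourier psi xi = 0.
  have [M [_ HM]] := compact_bounded cpsi.
  exists (Num.max M 0 + 1).
    by rewrite addr_ge0// le_max lexx orbT.
  move=> xi Mxi; apply/eqP; apply: contraTT Mxi => xi0; rewrite -leNgt.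
  apply: (HM (Num.max M 0 + 1)) => /=.
    by rewrite (@le_lt_trans _ _ (Num.max M 0)) ?ltrDl// le_max lexx.
  by apply: subset_closure.
(* For |xi| < r both a1 xi and a2 xi lie in the ball where the transform of psi
   is 1; for |xi| > rho both lie outside its support. *)
pose r := e / (a1 + a2).
have r0 : 0 < r by rewrite divr_gt0// addr_gt0.
pose rho := M / a1 + M / a2.
have rho0 : 0 <= rho by rewrite addr_ge0// divr_ge0// ltW.
exists (r `^ (- alpha) * (b + b)); exists rho; split; [|exact: rho0|].
  by rewrite mulr_ge0 ?powR_ge0 ?addr_ge0.
move=> xi; have [th0|thn0] := eqVneq (fourier (besov_piece A psi k) xi) 0.
  rewrite /besov_multiplier th0 mulr0 normc0 mulr_ge0//.
  by rewrite mulr_ge0 ?powR_ge0 ?addr_ge0.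
have a12 : 0 < a1 + a2 by exact: addr_gt0.
have rxi : r <= enorm xi.
  rewrite leNgt; apply: contra thn0 => xir.
  have xie : `|xi| * (a1 + a2) < e.
    by rewrite -ltr_pdivlMr// (le_lt_trans (norm_le_enorm xi)).
  rewrite thE !He' ?subrr// normrZ gtr0_norm// mulrC (le_lt_trans _ xie)//;
  by rewrite ler_wpM2l// ?lerDl ?lerDr ltW.
have xirho : `|xi| <= rho.
  rewrite leNgt; apply: contra thn0 => rhoxi.
  rewrite thE !HM ?subrr// normrZ gtr0_norm// -ltr_pdivrMl// mulrC;
  rewrite (le_lt_trans _ rhoxi)// ?lerDl ?lerDr divr_ge0// ltW//.
have xicube : cube rho xi.
  move=> j /=; rewrite in_itv/= -ler_norml (le_trans _ xirho)//.
  rewrite [leRHS]/Num.Def.normr/= mx_normrE.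
  by apply/bigmax_geP; right; exists (0, j).
rewrite indicE mem_set// mulr1 /besov_multiplier normcM; apply: ler_pM => //.
- exact: normc_ge0.
- exact: normc_ge0.
- rewrite normcE/= expr0n/= addr0 sqrtr_sqr ger0_norm ?powR_ge0//.
  rewrite !powRN lef_pV2 ?posrE ?powR_gt0//; last exact: lt_le_trans rxi.
  by apply: ge0_ler_powR; rewrite ?nnegrE// ?enorm_ge0// ltW.
Qed.

End besov_multiplier.

(** * The grid of mesh 1/N.+1 *)

Section grid.
Context {R : realType} {n : nat}.
Local Notation lambda := (lebesgue_rV R n).
Variable N : nat.
Local Notation N' := (N.+1%:R : R).

(** The grid is indexed by integer vectors; the shift from N to N.+1 keeps the mesh
    positive. *)
Definition cell_index (x : 'rV[R]_n) : 'rV[int]_n := \row_j Num.floor (N' * x 0 j).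

Definition grid_point (v : 'rV[int]_n) : 'rV[R]_n := \row_j ((v 0 j)%:~R / N').

Definition cell (v : 'rV[int]_n) : set 'rV[R]_n := [set x | cell_index x = v].

Lemma cell_indexD x v : cell_index (x + grid_point v) = cell_index x + v.
Proof.
apply/rowP => j; rewrite !mxE mulrDr mulrCA divff ?pnatr_eq0// mulr1.
by rewrite floorDrz ?intrKfloor// intr_int.
Qed.

Lemma cellE v x : cell v x <->
  forall j, (v 0 j)%:~R / N' <= x 0 j < (v 0 j + 1)%:~R / N'.
Proof.
have N0 : 0 < N' by rewrite ltr0n.
have jE j : ((v 0 j)%:~R / N' <= x 0 j < (v 0 j + 1)%:~R / N') =
    (Num.floor (N' * x 0 j) == v 0 j).
  by rewrite floor_eq ler_pdivrMr// ltr_pdivlMr// mulrC.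
split => [vx j|vx]; first by rewrite jE -vx mxE.
by apply/rowP => j; rewrite mxE; apply/eqP; rewrite -jE.
Qed.

Lemma measurable_cell v : measurable (cell v).
Proof.
rewrite (_ : cell v = \bigcap_(j in [set: 'I_n])
    (fun x : 'rV[R]_n => x 0 j) @^-1` `[(v 0 j)%:~R / N', (v 0 j + 1)%:~R / N'[).
  apply: fin_bigcap_measurable => // j _; rewrite -[X in measurable X]setTI.
  exact: measurable_coord.
apply/seteqP; split => x /=.
  by move=> /cellE vx j _; rewrite /= in_itv/=.
by move=> vx; apply/cellE => j; have := vx j I; rewrite /= in_itv/=.
Qed.

Lemma integral_cell0 : (\int[lambda]_x (\1_(cell 0) x)%:E = (N' ^- n)%:E)%E.
Proof.
have N0 : 0 < N' by rewrite ltr0n.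
pose f (j : 'I_n) (t : R) : R := \1_(`[0, N'^-1[%classic) t.
have -> : (\int[lambda]_x (\1_(cell 0) x)%:E =
    \int[lambda]_x (\prod_j f j (x 0%R j))%:E)%E.
  apply: eq_integral => x _; congr EFin.
  have [c0|nc0] := pselect (cell 0 x).
    rewrite indicE mem_set// big1// => j _; rewrite /f indicE mem_set//=.
    by have /cellE/(_ j) := c0; rewrite mxE add0r mul0r mul1r in_itv.
  rewrite indicE memNset//; apply/esym/eqP; rewrite prodf_seq_eq0.
  apply/hasP; move: nc0 => /contra_notP; apply => nj.
  apply/cellE => j; rewrite mxE add0r mul0r mul1r.
  apply: contrapT => jn; apply: nj; exists j; first by rewrite mem_index_enum.
  by rewrite /= /f indicE memNset//= in_itv.
rewrite integral_rV_prod//; last by move=> j; exact: measurable_indic.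
rewrite (eq_bigr (fun=> (N'^-1)%:E)) => [|j _].
  by rewrite prodEFin prodr_const card_ord exprVn.
transitivity (@lebesgue_measure R `[0%R, N'^-1[%classic).
  by rewrite integral_indic// setIT.
by rewrite lebesgue_measure_itv/= lte_fin invr_gt0 N0 -EFinB subr0.
Qed.

(** The cells partition R^n and each is a translate of the one at the origin.
    Integer vectors are enumerated by [pickle_inv], and the indices that code no
    vector contribute 0. *)
Lemma ge0_integral_tiling (F : 'rV[R]_n -> \bar R) :
  measurable_fun setT F -> (forall x, (0 <= F x)%E) ->
  (\int[lambda]_x F x = \int[lambda]_(z in cell 0)
    \sum_(i <oo) (if pickle_inv i is Some v then F (z + grid_point v)%R else 0))%E.
Proof.
move=> mF F0.
pose D i : set 'rV[R]_n := if pickle_inv i is Some v then cell v else set0.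
have mD i : measurable (D i).
  by rewrite /D; case: pickle_inv => [v|//]; exact: measurable_cell.
have DT : \bigcup_i D i = setT.
  rewrite -subTset => x _; exists (pickle (cell_index x)) => //.
  by rewrite /D pickleK_inv.
have tD : trivIset setT D.
  apply/trivIsetP => i j _ _ ij; rewrite -subset0 /D => x [].
  have := @pickle_invK 'rV[int]_n i; have := @pickle_invK 'rV[int]_n j.
  case: pickle_inv => [w|//] /= wj; case: pickle_inv => [v|//] /= vi vx wx.
  by move: ij; rewrite -vi -wj -vx -wx eqxx.
have mFv v : measurable_fun setT (fun z : 'rV[R]_n => F (z + grid_point v)).
  have := measurableT_comp mF (measurable_affine_rV 1 (grid_point v)).
  by apply: eq_measurable_fun => z _ /=; rewrite scale1r.
rewrite -[LHS](_ : (\int[lambda]_(x in \bigcup_i D i) F x)%E = _); last by rewrite DT.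
rewrite ge0_integral_bigcup//; last by rewrite DT.
rewrite integral_nneseries//; last 3 first.
- exact: measurable_cell.
- move=> i; case: pickle_inv => [v|]; last exact: measurable_cst.
  exact: measurable_funS (mFv v).
- by move=> i x _; case: pickle_inv.
apply: eq_eseriesr => i _; rewrite /D; case: pickle_inv => [v|]; last first.
  by rewrite integral_set0 integral0.
rewrite integral_mkcond [RHS]integral_mkcond.
have n10 : (1 : R) != 0 by exact: oner_neq0.
rewrite -(@ge0_integral_affine _ _ 1 (grid_point v) (F \_ (cell v)))//; last 2 first.
- by apply/(measurable_restrictT _ (measurable_cell v)); exact: measurable_funS mF.
- by move=> x; rewrite patchE; case: ifP.
rewrite normr1 expr1n mule1; apply: eq_integral => z _.
rewrite scale1r !patchE; congr (if _ then _ else _).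
apply/idP/idP; rewrite !inE /cell/= cell_indexD; last by move=> ->; rewrite add0r.
by move/(canRL (addrK v)); rewrite subrr.
Qed.

End grid.

(** * Averages of a measure over reflected cells *)

Section complex_fubini.
Context {R : realType} {d1 d2 : measure_display} {T1 : measurableType d1}
  {T2 : measurableType d2}.
Variables (m1 : {sigma_finite_measure set T1 -> \bar R})
  (m2 : {sigma_finite_measure set T2 -> \bar R}).

(** All sections, and not only almost all of them, are assumed integrable, so that
    the real-valued inner integrals agree everywhere with the extended ones. *)
Lemma Rintegral_Fubini (f : T1 * T2 -> R) :
  (m1 \x m2)%E.-integrable setT (EFin \o f) ->
  (forall x, m2.-integrable setT (fun y => (f (x, y))%:E)) ->
  (forall y, m1.-integrable setT (fun x => (f (x, y))%:E)) ->
  \int[m1]_x \int[m2]_y f (x, y) = \int[m2]_y \int[m1]_x f (x, y).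
Proof.
move=> fi f2 f1; congr fine.
transitivity (\int[m1]_x \int[m2]_y (EFin \o f) (x, y))%E.
  by apply: eq_integral => x _; rewrite /Rintegral fineK// integrable_fin_num.
rewrite Fubini//.
by apply: eq_integral => y _; rewrite /Rintegral fineK// integrable_fin_num.
Qed.

Lemma cintegral_Fubini (f : T1 * T2 -> R[i]) (g : T1 * T2 -> R) :
  cmeasurable f -> (forall p, normc (f p) <= g p) ->
  (m1 \x m2)%E.-integrable setT (EFin \o g) ->
  (forall x, m2.-integrable setT (fun y => (g (x, y))%:E)) ->
  (forall y, m1.-integrable setT (fun x => (g (x, y))%:E)) ->
  cintegral m1 (fun x => cintegral m2 (fun y => f (x, y))) =
  cintegral m2 (fun y => cintegral m1 (fun x => f (x, y))).
Proof.
move=> mf fg gi g2 g1; have [fi1 fi2] := le_cintegrable mf fg gi.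
have [m1f m2f] := mf.
have cm1 y : cmeasurable (fun x => f (x, y)).
  by split; [exact: (measurableT_comp m1f (pair2_measurable y))|
             exact: (measurableT_comp m2f (pair2_measurable y))].
have cm2 x : cmeasurable (fun y => f (x, y)).
  by split; [exact: (measurableT_comp m1f (pair1_measurable x))|
             exact: (measurableT_comp m2f (pair1_measurable x))].
have c1 y := le_cintegrable (cm1 y) (fun x => fg (x, y)) (g1 y).
have c2 x := le_cintegrable (cm2 x) (fun y => fg (x, y)) (g2 x).
rewrite /cintegral /=.
rewrite (@Rintegral_Fubini (fun p => complex.Re (f p)))//; last 2 first.
- by move=> x; have [] := c2 x.
- by move=> y; have [] := c1 y.
rewrite (@Rintegral_Fubini (fun p => complex.Im (f p)))//.
- by move=> x; have [] := c2 x.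
- by move=> y; have [] := c1 y.
Qed.

End complex_fubini.

Section averages.
Context {R : realType} {n : nat}.
Local Notation lambda := (lebesgue_rV R n).
Variable N : nat.
Local Notation N' := (N.+1%:R : R).

(** The set x - Q, where Q is the cell at the origin: its mass is the value at x of
    the convolution of the measure with the indicator of Q. *)
Definition reflected_cell (x : 'rV[R]_n) : set 'rV[R]_n := [set y | cell N 0 (x - y)].

Lemma measurable_rVB {dT} {T : measurableType dT} (f g : T -> 'rV[R]_n) :
  measurable_fun setT f -> measurable_fun setT g ->
  measurable_fun setT (fun t => f t - g t).
Proof.
move=> mf mg; apply: measurable_rV => j; under eq_fun do rewrite !mxE.
apply: measurable_funB; first exact: (measurableT_comp (measurable_coord j) mf).
exact: (measurableT_comp (measurable_coord j) mg).
Qed.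

Lemma measurable_indic_cell : measurable_fun setT (\1_(cell N 0) : 'rV[R]_n -> R).
Proof. by apply: measurable_indic; exact: measurable_cell. Qed.

Lemma measurable_indic_cellB {dT} {T : measurableType dT} (f g : T -> 'rV[R]_n) :
  measurable_fun setT f -> measurable_fun setT g ->
  measurable_fun setT (fun t => \1_(cell N 0) (f t - g t) : R).
Proof.
move=> mf mg; apply: (@measurableT_comp _ _ _ _ _ _ (\1_(cell N 0) : _ -> R)).
  exact: measurable_indic_cell.
exact: measurable_rVB.
Qed.

Lemma measurable_reflected_cell x : measurable (reflected_cell x).
Proof.
rewrite -[reflected_cell x]setTI.
have mB : measurable_fun setT (fun y : 'rV[R]_n => x - y) by exact: measurable_rVB.
exact: (mB measurableT _ (@measurable_cell R n N 0)).
Qed.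

Lemma integral_cellB y : (\int[lambda]_x (\1_(cell N 0) (x - y))%:E = (N' ^- n)%:E)%E.
Proof.
rewrite -integral_cell0.
rewrite -(@ge0_integral_affine _ _ 1 (- y) (fun x => (\1_(cell N 0) x)%:E))//; last first.
  by apply/measurable_EFinP; exact: measurable_indic_cell.
by rewrite normr1 expr1n mule1; apply: eq_integral => x _; rewrite scale1r.
Qed.

Lemma integrable_indic_cell :
  lambda.-integrable setT (fun x => (\1_(cell N 0) x)%:E).
Proof.
apply/integrableP; split.
  by apply/measurable_EFinP; exact: measurable_indic_cell.
by under eq_integral do rewrite /= ger0_norm//; rewrite integral_cell0 ltry.
Qed.

Section finite_measure.
Variable nu : {finite_measure set 'rV[R]_n -> \bar R}.

Definition cell_average (x : 'rV[R]_n) : R := fine (nu (reflected_cell x)).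

Lemma cell_averageE x : cell_average x = \int[nu]_y \1_(cell N 0) (x - y).
Proof.
rewrite /cell_average /Rintegral -[in LHS](setIT (reflected_cell x)) -integral_indic//.
exact: measurable_reflected_cell.
Qed.

Let G (p : 'rV[R]_n * 'rV[R]_n) : R := \1_(cell N 0) (p.1 - p.2).

Let mG : measurable_fun setT G.
Proof. by apply: measurable_indic_cellB. Qed.

Let G0 p : 0 <= G p.
Proof. by rewrite /G. Qed.

Let G2 x : nu.-integrable setT (fun y => (G (x, y))%:E).
Proof.
have mi := measurable_reflected_cell x.
apply: (eq_integrable measurableT _ _ _ (integrable_indic nu mi)).
by move=> y _; congr EFin; rewrite /G /= !indicE.
Qed.

Let G1 y : lambda.-integrable setT (fun x => (G (x, y))%:E).
Proof.
have := @integrable_affine _ _ 1 (- y) _ (oner_neq0 R) integrable_indic_cell.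
apply: eq_integrable => // x _; congr EFin.
by rewrite /G/= scale1r.
Qed.

Let Gi : (lambda \x nu)%E.-integrable setT (EFin \o G).
Proof.
apply/integrable21ltyP; first exact/measurable_EFinP.
under eq_integral => y _.
  rewrite (_ : (\int[lambda]_x _)%E = (N' ^- n)%:E); first over.
  rewrite -(integral_cellB y); apply: eq_integral => x _ /=.
  by rewrite ger0_norm.
rewrite integral_cst// lte_mul_pinfty// ?lee_fin// ?invr_ge0 ?exprn_ge0//.
exact: fin_num_fun_lty.
Qed.

Lemma integrable_cell_average : lambda.-integrable setT (fun x => (cell_average x)%:E).
Proof.
apply: (eq_integrable measurableT _ _ _ (integrable_fubini_F Gi)).
move=> x _; rewrite cell_averageE /fubini_F /Rintegral fineK//.
exact: (integrable_fin_num measurableT (G2 x)).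
Qed.

(** The convolution theorem: exchange the integrals, then translate the inner one
    by y, which factors the character. *)
Lemma fourier_cell_average xi :
  fourier (fun x => (cell_average x)%:C) xi =
  fourier (fun z => (\1_(cell N 0) z)%:C) xi *
  cintegral nu (fun y => cis (- (2 * pi * dotp xi y))).
Proof.
pose K (p : 'rV[R]_n * 'rV[R]_n) : R[i] :=
  cis (- (2 * pi) * dotp xi p.1) * (G p)%:C.
have mK : cmeasurable K.
  apply: cmeasurableM; last exact: cmeasurable_real.
  exact: cmeasurable_cis_dotp.
have nR (r : R) : 0 <= r -> normc r%:C = r.
  by move=> r0; rewrite normcE/= expr0n addr0 sqrtr_sqr ger0_norm.
have KG p : normc (K p) <= G p by rewrite normcM normc_cis mul1r nR.
transitivity (cintegral lambda (fun x => cintegral nu (fun y => K (x, y)))).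
  rewrite fourierE; apply: eq_cintegral => x.
  have gi : cintegrable nu (fun y => (G (x, y))%:C).
    by split => //=; exact: integrable0.
  rewrite /K/= cintegralZ//; congr (_ * _).
  rewrite cell_averageE /cintegral/=; congr (_ +i* _).
  by rewrite /Rintegral integral0.
rewrite (cintegral_Fubini mK KG)//.
have ci : cintegrable lambda (fun z => cis (- (2 * pi) * dotp xi z) * (\1_(cell N 0) z)%:C).
  apply: cintegrable_cisM; split => /=; last exact: integrable0.
  exact: integrable_indic_cell.
transitivity (cintegral nu (fun y => fourier (fun z => (\1_(cell N 0) z)%:C) xi *
    cis (- (2 * pi * dotp xi y)))).
  apply: eq_cintegral => y.
  rewrite fourierE mulrC -cintegralZ//.
  have ciy : cintegrable lambda (fun z => cis (- (2 * pi * dotp xi y)) *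
      (cis (- (2 * pi) * dotp xi z) * (\1_(cell N 0) z)%:C)) by exact: cintegrableZ.
  rewrite -(cintegral_affine (- y) (oner_neq0 R) ciy) normr1 expr1n mul1r.
  apply: eq_cintegral => z; rewrite /K /G /= scale1r mulrA -cisD.
  by congr (cis _ * _); rewrite dotpDr dotpNr; ring.
rewrite cintegralZ//.
apply: (@le_cintegrable _ _ _ _ _ (cst 1)).
- under [X in cmeasurable X]eq_fun do rewrite -mulNr.
  exact: cmeasurable_cis_dotp.
- by move=> y; rewrite normc_cis.
- exact: finite_measure_integrable_cst.
Qed.

End finite_measure.
End averages.

(** * Averages of a vector charge *)

Section charge_averages.
Context {R : realType} {n : nat}.
Local Notation lambda := (lebesgue_rV R n).
Local Notation borel_charge := ({charge set 'rV[R]_n -> \bar R})%type.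

Definition jpos (nu : borel_charge) : {finite_measure set 'rV[R]_n -> \bar R} :=
  jordan_pos (svalP (hahn_sets nu)).

Definition jneg (nu : borel_charge) : {finite_measure set 'rV[R]_n -> \bar R} :=
  jordan_neg (svalP (hahn_sets nu)).

Lemma fine_charge_jordan (nu : borel_charge) (A : set 'rV[R]_n) : measurable A ->
  fine (nu A) = fine (jpos nu A) - fine (jneg nu A).
Proof.
move=> mA; rewrite (jordan_decomp (svalP (hahn_sets nu)) mA).
rewrite /cadd/= cscaleN1 fineD ?fineN//; [exact: fin_num_measure|].
by rewrite fin_numN; exact: fin_num_measure.
Qed.

Lemma charge_cintegralE (nu : borel_charge) (f : 'rV[R]_n -> R[i]) :
  charge_cintegral nu f = cintegral (jpos nu) f - cintegral (jneg nu) f.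
Proof. by []. Qed.

Lemma cintegrable_real (mu : {measure set 'rV[R]_n -> \bar R}) (f : 'rV[R]_n -> R) :
  mu.-integrable setT (fun x => (f x)%:E) -> cintegrable mu (fun x => (f x)%:C).
Proof. by split => //=; exact: integrable0. Qed.

Variable N : nat.
Local Notation N' := (N.+1%:R : R).

Lemma charge_reflected_cell (nu : borel_charge) x :
  (fine (nu (reflected_cell N x)))%:C =
  (cell_average N (jpos nu) x)%:C - (cell_average N (jneg nu) x)%:C.
Proof. by rewrite fine_charge_jordan ?rmorphB//; exact: measurable_reflected_cell. Qed.

Lemma cintegrable_charge_reflected_cell (nu : borel_charge) :
  cintegrable lambda (fun x => (fine (nu (reflected_cell N x)))%:C).
Proof.
under [X in cintegrable _ X]eq_fun do rewrite charge_reflected_cell.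
by apply: cintegrableB; apply: cintegrable_real; exact: integrable_cell_average.
Qed.

Lemma fourier_charge_reflected_cell (nu : borel_charge) xi :
  fourier (fun x => (fine (nu (reflected_cell N x)))%:C) xi =
  fourier (fun z : 'rV[R]_n => (\1_(cell N 0) z)%:C) xi *
  charge_cintegral nu (fun y => cis (- (2 * pi * dotp xi y))).
Proof.
rewrite (_ : (fun x => _) = fun x => (cell_average N (jpos nu) x)%:C -
    (cell_average N (jneg nu) x)%:C); last first.
  by apply/funext => x; exact: charge_reflected_cell.
rewrite fourierB; last 2 first.
- by apply: cintegrable_real; exact: integrable_cell_average.
- by apply: cintegrable_real; exact: integrable_cell_average.
by rewrite !fourier_cell_average charge_cintegralE mulrBr.
Qed.

(** The Fourier transform of the normalised indicator of the cell at the origin. *)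
Definition cell_weight (xi : 'rV[R]_n) : R[i] :=
  (N' ^+ n)%:C * fourier (fun z : 'rV[R]_n => (\1_(cell N 0) z)%:C) xi.

Section vector_charge.
Variables (l : nat) (mu : vcharge R 'rV[R]_n l).

(** The convolution of mu with the normalised indicator of the cell at the origin. *)
Definition mollify (x : 'rV[R]_n) : 'rV[R[i]]_l :=
  (N' ^+ n)%:C *: vcharge_val mu (reflected_cell N x).

Lemma mollify_coordE x j : mollify x 0 j = (N' ^+ n)%:C *
  ((fine (vcharge_re mu j (reflected_cell N x)))%:C +
   (0 +i* 1) * (fine (vcharge_im mu j (reflected_cell N x)))%:C).
Proof.
rewrite !mxE; congr (_ * _); apply/eqP; rewrite eq_complex/=.
by rewrite !mul0r !mul1r subr0 !addr0 !add0r !eqxx.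
Qed.

Lemma cintegrable_mollify j : cintegrable lambda (fun x => mollify x 0 j).
Proof.
under [X in cintegrable _ X]eq_fun do rewrite mollify_coordE.
apply: cintegrableZ; apply: cintegrableD; last apply: cintegrableZ;
  exact: cintegrable_charge_reflected_cell.
Qed.

Lemma L1_mollify : L1 mollify.
Proof. by move=> j; exact: cintegrable_mollify. Qed.

(** Mollification multiplies the transform by a scalar, hence preserves every
    constraint of membership in a linear subspace. *)
Lemma vfourier_mollify xi : vfourier mollify xi = cell_weight xi *: charge_fourier mu xi.
Proof.
apply/rowP => j; rewrite !mxE.
rewrite (_ : (fun x => mollify x 0 j) = fun x => (N' ^+ n)%:C *
  ((fine (vcharge_re mu j (reflected_cell N x)))%:C +
   (0 +i* 1) * (fine (vcharge_im mu j (reflected_cell N x)))%:C)); last first.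
  by apply/funext => x; exact: mollify_coordE.
have i1 := cintegrable_charge_reflected_cell (vcharge_re mu j).
have i2 := cintegrable_charge_reflected_cell (vcharge_im mu j).
rewrite fourierE.
rewrite (_ : (fun x => _) = fun x => (N' ^+ n)%:C *
  (cis (- (2 * pi) * dotp xi x) * (fine (vcharge_re mu j (reflected_cell N x)))%:C +
  (0 +i* 1) * (cis (- (2 * pi) * dotp xi x) * (fine (vcharge_im mu j (reflected_cell N x)))%:C)));
  last by apply/funext => x; ring.
have c1 := cintegrable_cisM (- (2 * pi)) xi i1.
have c2 := cintegrable_cisM (- (2 * pi)) xi i2.
rewrite cintegralZ; last by apply: cintegrableD => //; exact: cintegrableZ.
rewrite cintegralD//; last exact: cintegrableZ.
rewrite cintegralZ// -!fourierE !fourier_charge_reflected_cell /cell_weight; ring.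
Qed.

Lemma cnormZ (c : R) (v : 'rV[R[i]]_l) : 0 <= c -> cnorm (c%:C *: v) = c * cnorm v.
Proof.
move=> c0; rewrite /cnorm -[X in X * _](ger0_norm c0) -sqrtr_sqr -sqrtrM ?sqr_ge0//.
congr Num.sqrt; rewrite mulr_sumr; apply: eq_bigr => j _; rewrite !mxE cReM cImM/=.
ring.
Qed.

Lemma cnorm_ge0 (v : 'rV[R[i]]_l) : 0 <= cnorm v.
Proof. exact: sqrtr_ge0. Qed.

Lemma cnorm0 : cnorm (0 : 'rV[R[i]]_l) = 0.
Proof.
rewrite /cnorm big1 ?sqrtr0// => j _; rewrite mxE/= expr0n/= addr0//.
Qed.

Lemma measurable_cnorm {dT} {T : measurableType dT} (f : T -> 'rV[R[i]]_l) :
  (forall j, cmeasurable (fun x => f x 0 j)) -> measurable_fun setT (fun x => cnorm (f x)).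
Proof.
move=> mf; apply: (@measurableT_comp _ _ _ _ _ _ (@Num.sqrt R)).
  by apply: continuous_measurable_fun; exact: sqrt_continuous.
apply: measurable_sum => j; have [m1 m2] := mf j.
by apply: measurable_funD; exact: measurable_funX.
Qed.

(** For a fixed z, the sets z + v/N.+1 - Q with v an integer vector partition R^n,
    so the masses that mu gives them have norms adding up to at most the variation
    of mu.  By the tiling of R^n, the L_1 norm is the mean of these sums over z in
    the cell at the origin. *)
Lemma L1_norm_mollify : (L1_norm mollify <= vcharge_variation mu)%E.
Proof.
have N0 : 0 < N' ^+ n by rewrite exprn_gt0// ltr0n.
have mF : measurable_fun setT (fun x => (cnorm (mollify x))%:E).
  apply/measurable_EFinP/measurable_cnorm => j.
  exact: cintegrable_cmeasurable (cintegrable_mollify j).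
have F0 x : (0 <= (cnorm (mollify x))%:E)%E by rewrite lee_fin cnorm_ge0.
rewrite /L1_norm (ge0_integral_tiling N mF F0).
have mFi (i : nat) : measurable_fun (cell N 0 : set 'rV[R]_n) (fun z : 'rV[R]_n =>
  if @pickle_inv 'rV[int]_n i is Some v then (cnorm (mollify (z + grid_point N v)))%:E else 0%E).
  case: pickle_inv => [v|]; last exact: measurable_cst.
  have := measurableT_comp mF (measurable_affine_rV 1 (grid_point N v)).
  move=> h; apply: measurable_funTS; apply: eq_measurable_fun h => z _ /=.
  by rewrite scale1r.
have sumle (z : 'rV[R]_n) : (\sum_(i <oo)
    (if @pickle_inv 'rV[int]_n i is Some v then (cnorm (mollify (z + grid_point N v)))%:E else 0)
    <= (N' ^+ n)%:E * vcharge_variation mu)%E.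
  pose E i : set 'rV[R]_n := if @pickle_inv 'rV[int]_n i is Some v then
    reflected_cell N (z + grid_point N v) else set0.
  (* A point y lies in exactly one of the sets, that of v = - cell_index (z - y). *)
  have Ev v y : reflected_cell N (z + grid_point N v) y <-> v = - cell_index N (z - y).
    rewrite /reflected_cell/= /cell/= addrAC cell_indexD; split => [/eqP|->].
      by rewrite addr_eq0 => /eqP ->; rewrite opprK.
    by rewrite subrr.
  rewrite (@eq_eseriesr _ _ (fun i => (N' ^+ n)%:E * (cnorm (vcharge_val mu (E i)))%:E)%E);
      last first.
    move=> i _; rewrite /E; case: pickle_inv => [v|].
      by rewrite /mollify cnormZ ?EFinM// ltW.
    rewrite (_ : vcharge_val mu set0 = 0) ?cnorm0 ?mule0//.
    by apply/rowP => j; rewrite !mxE !charge0.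
  rewrite nneseriesZl; last by move=> i _; rewrite lee_fin cnorm_ge0.
  apply: lee_wpmul2l; first by rewrite lee_fin ltW.
  apply: ereal_sup_ubound; exists E => //; split.
  - move=> i; rewrite /E; case: pickle_inv => [v|//].
    exact: measurable_reflected_cell.
  - apply/trivIsetP => i j _ _ ij; rewrite -subset0 /E => y [].
    have := @pickle_invK 'rV[int]_n i; have := @pickle_invK 'rV[int]_n j.
    case: pickle_inv => [w|//] /= wj; case: pickle_inv => [v|//] /= vi /Ev vy /Ev wy.
    by move: ij; rewrite -vi -wj vy wy eqxx.
  - rewrite -subTset => y _; exists (pickle (- cell_index N (z - y))) => //.
    by rewrite /E pickleK_inv; exact/Ev.
have [->|varoo] := eqVneq (vcharge_variation mu) +oo%E; first exact: leey.
have var0 : (0 <= vcharge_variation mu)%E.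
  rewrite -(@lee_pmul2l _ (N' ^+ n)%:E) ?lte_fin// mule0.
  apply: le_trans (sumle 0); apply: nneseries_ge0 => i _ _.
  by case: pickle_inv => [v|//]; rewrite lee_fin cnorm_ge0.
have varE : vcharge_variation mu = (fine (vcharge_variation mu))%:E.
  by rewrite fineK// ge0_fin_numE// ltey.
apply: (@le_trans _ _ (\int[lambda]_(z in cell N 0) ((N' ^+ n)%:E * vcharge_variation mu))%E).
  apply: ge0_le_integral => //.
  - exact: measurable_cell.
  - move=> z _; apply: nneseries_ge0 => i _ _.
    by case: pickle_inv => [v|//]; rewrite lee_fin cnorm_ge0.
  - apply: ge0_emeasurable_sum => [i z _ _|i _]; last exact: mFi.
    by case: pickle_inv => [v|//]; rewrite lee_fin cnorm_ge0.
rewrite varE -EFinM integral_cst; last exact: measurable_cell.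
rewrite [X in (_ * X <= _)%E](_ : _ = (N' ^- n)%:E); last first.
  by rewrite -(@integral_cell0 R n N) integral_indic ?setIT//; exact: measurable_cell.
by rewrite -EFinM mulrC mulrA mulVf ?mul1r// gt_eqF.
Qed.

Lemma charge_fourier_coordE xi j : charge_fourier mu xi 0 j =
  charge_cintegral (vcharge_re mu j) (fun x => cis (- (2 * pi * dotp xi x))) +
  (0 +i* 1) * charge_cintegral (vcharge_im mu j) (fun x => cis (- (2 * pi * dotp xi x))).
Proof. by rewrite mxE. Qed.

(** The transform is a combination of integrals of a unimodular function against
    the four finite Jordan parts of the coordinate. *)
Lemma charge_fourier_bounded j : cmeasurable (fun xi => charge_fourier mu xi 0 j) /\
  exists M, forall xi, normc (charge_fourier mu xi 0 j) <= M.
Proof.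
have mc (nu : {finite_measure set 'rV[R]_n -> \bar R}) :
    cmeasurable (fun xi => cintegral nu (fun x => cis (- (2 * pi * dotp xi x)))).
  pose F (p : 'rV[R]_n * 'rV[R]_n) : R[i] := cis (- (2 * pi * dotp p.1 p.2)).
  apply: (@cmeasurable_cintegral_param _ _ _ _ _ nu F).
  rewrite /F; under [X in cmeasurable X]eq_fun do rewrite -mulNr.
  exact: cmeasurable_cis_dotp.
have nc (nu : {finite_measure set 'rV[R]_n -> \bar R}) xi :
    normc (cintegral nu (fun x => cis (- (2 * pi * dotp xi x)))) <=
    2 * \int[nu]_x 1.
  apply: normc_cintegral_le.
  - under [X in cmeasurable X]eq_fun do rewrite -mulNr.
    exact: cmeasurable_cis_dotp.
  - by move=> x; rewrite normc_cis.
  - exact: finite_measure_integrable_cst.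
have mch (nu : borel_charge) :
    cmeasurable (fun xi => charge_cintegral nu (fun x => cis (- (2 * pi * dotp xi x)))).
  under [X in cmeasurable X]eq_fun do rewrite charge_cintegralE.
  by apply: cmeasurableD => //; exact: cmeasurableN.
have nch (nu : borel_charge) xi :
    normc (charge_cintegral nu (fun x => cis (- (2 * pi * dotp xi x)))) <=
    2 * \int[jpos nu]_x 1 + 2 * \int[jneg nu]_x 1.
  rewrite charge_cintegralE (le_trans (le_normcD _ _))// normcN.
  by apply: lerD.
split.
  under [X in cmeasurable X]eq_fun do rewrite charge_fourier_coordE.
  by apply: cmeasurableD => //; apply: cmeasurableM => //; exact: cmeasurable_cst.
eexists => xi; rewrite charge_fourier_coordE (le_trans (le_normcD _ _))// normcM.
by apply: lerD; [exact: nch|apply: ler_wpM2l; [exact: normc_ge0|exact: nch]].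
Qed.

End vector_charge.
End charge_averages.

(** * Uniform approximation of the pieces of the Riesz potential *)

Section cell_weight_estimate.
Context {R : realType} {n : nat}.
Local Notation lambda := (lebesgue_rV R n).

Lemma normr_sin_le (t : R) : `|sin t| <= `|t|.
Proof.
wlog t0 : t / 0 <= t.
  move=> H; have [t0|t0] := leP 0 t; first exact: H.
  by rewrite -normrN -sinN -(normrN t); apply: H; rewrite oppr_ge0 ltW.
have [c _] := @MVT_segment R sin cos 0 t t0 (fun x _ => is_derive_sin x)
  (continuous_subspaceT (@continuous_sin R)).
rewrite sin0 !subr0 => ->; rewrite normrM -[leRHS]mul1r ler_wpM2r//.
exact: cos_max.
Qed.

Lemma normr_cosB1_le (t : R) : `|cos t - 1| <= `|t|.
Proof.
wlog t0 : t / 0 <= t.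
  move=> H; have [t0|t0] := leP 0 t; first exact: H.
  by rewrite -cosN -(normrN t); apply: H; rewrite oppr_ge0 ltW.
have [c _] := @MVT_segment R cos (fun x => - sin x) 0 t t0 (fun x _ => is_derive_cos x)
  (continuous_subspaceT (@continuous_cos R)).
rewrite cos0 !subr0 => ->; rewrite normrM normrN -[leRHS]mul1r ler_wpM2r//.
exact: sin_max.
Qed.

Lemma normc_cisB1_le (t : R) : normc (cis t - 1) <= 2 * `|t|.
Proof.
rewrite (le_trans (normc_le_ReIm _))// /cis/= oppr0 addr0 mulr_natl mulr2n.
by apply: lerD; [exact: normr_cosB1_le|exact: normr_sin_le].
Qed.

Lemma normr_dotp_cell N rho (xi z : 'rV[R]_n) : cube rho xi -> cell N 0 z ->
  `|dotp xi z| <= n%:R * rho / N.+1%:R.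
Proof.
move=> xir /cellE zc; rewrite (le_trans (ler_norm_sum _ _ _))//.
rewrite -[X in X%:R]card_ord -mulrA mulr_natl -sumr_const; apply: ler_sum => j _.
have := zc j; rewrite mxE add0r mul0r mul1r => /andP[z0 z1].
rewrite normrM; apply: ler_pM => //.
  by have := xir j; rewrite in_itv/= ler_norml.
by rewrite ger0_norm// ltW.
Qed.

(** For xi in a bounded set and z in the cell, the phase <xi, z> is O(1/N). *)
Lemma cell_weightB1 rho : exists C : R, forall N (xi : 'rV[R]_n), cube rho xi ->
  normc (cell_weight N xi - 1) <= C / N.+1%:R.
Proof.
pose c := 2 * (2 * pi * (n%:R * rho)).
exists (2 * c) => N xi xir.
have N0 : 0 < N.+1%:R ^+ n :> R by rewrite exprn_gt0// ltr0n.
have i1 : cintegrable lambda (fun z => (\1_(cell N 0) z)%:C).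
  by apply: cintegrable_real; exact: integrable_indic_cell.
have one : (N.+1%:R ^+ n)%:C * cintegral lambda (fun z => (\1_(cell N 0) z)%:C) = 1.
  rewrite /cintegral/= {2}/Rintegral integral0/= /Rintegral integral_cell0/=.
  apply/eqP; rewrite eq_complex/= !mul0r !mulr0 subr0 addr0.
  by rewrite mulfV ?eqxx// lt0r_neq0.
rewrite -[X in _ - X]one /cell_weight -mulrBr fourierE -cintegralB//; last first.
  exact: cintegrable_cisM.
rewrite normcM normcE/= expr0n addr0 sqrtr_sqr ger0_norm; last exact: ltW.
have ig : lambda.-integrable setT (EFin \o (fun z => (c / N.+1%:R) * \1_(cell N 0) z)).
  apply: (eq_integrable measurableT _ _ _ (integrableZl measurableT (c / N.+1%:R)
    (@integrable_indic_cell R n N))).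
  by move=> z _; rewrite /= EFinM.
apply: (@le_trans _ _ (N.+1%:R ^+ n * (2 * \int[lambda]_z ((c / N.+1%:R) * \1_(cell N 0) z)))).
  apply: ler_wpM2l; first exact: ltW.
  apply: normc_cintegral_le => //.
    apply: (@cintegrable_cmeasurable _ _ _ lambda).
    by apply: cintegrableB => //; exact: cintegrable_cisM.
  move=> z; have [zc|nzc] := pselect (cell N 0 z); last first.
    by rewrite indicE memNset//= !mulr0 subrr normc0.
  rewrite indicE mem_set// !mulr1 (le_trans (normc_cisB1_le _))// /c -mulrA.
  have pi2 : 0 <= 2 * pi :> R by rewrite mulr_ge0// pi_ge0.
  rewrite ler_wpM2l// normrM normrN (ger0_norm pi2) -[leRHS]mulrA ler_wpM2l//.
  exact: normr_dotp_cell.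
rewrite RintegralZl//; last exact: integrable_indic_cell.
rewrite [X in _ * (_ * (_ * X))](_ : _ = (N.+1%:R ^- n)); last first.
  by rewrite /Rintegral integral_cell0.
rewrite le_eqVlt; apply/orP; left; apply/eqP.
move: (lt0r_neq0 N0); set P := N.+1%:R ^+ n => P0.
by rewrite [RHS]mulrAC mulrCA [X in 2 * X]mulrCA mulfV// mulr1 mulrAC -mulrA.
Qed.

End cell_weight_estimate.

Section riesz_pieces.
Context {R : realType} {n l : nat}.
Local Notation lambda := (lebesgue_rV R n).
Implicit Types (m : 'rV[R]_n -> 'rV[R[i]]_l).

Lemma riesz_pieceE (A : R) psi alpha k m x j : 0 < A -> schwartz psi ->
  distribution_conv (riesz alpha m) (besov_piece A psi k) x 0 j =
  cintegral lambda (fun xi => cis (2 * pi * dotp x xi) *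
    (besov_multiplier A psi alpha k xi * m xi 0 j)).
Proof.
move=> A0 sp; have ip := schwartz_cintegrable sp.
rewrite mxE; apply: eq_cintegral => xi.
rewrite mxE inverse_fourier_reflect; last first.
  by apply: cintegrableB; exact: cintegrable_dilate.
by rewrite /besov_multiplier dotpC; ring.
Qed.

Lemma measurable_riesz_piece (A : R) psi alpha k m : 0 < A -> schwartz psi ->
  cmeasurable (besov_multiplier A psi alpha k) ->
  (forall j, cmeasurable (fun xi => m xi 0 j)) ->
  measurable_fun setT
    (fun x => cnorm (distribution_conv (riesz alpha m) (besov_piece A psi k) x)).
Proof.
move=> A0 sp mk mm; apply: measurable_cnorm => j.
under [X in cmeasurable X]eq_fun do rewrite riesz_pieceE//.
pose F (p : 'rV[R]_n * 'rV[R]_n) : R[i] := cis (2 * pi * dotp p.1 p.2) *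
  (besov_multiplier A psi alpha k p.2 * m p.2 0 j).
apply: (@cmeasurable_cintegral_param _ _ _ _ _ lambda F).
apply: cmeasurableM; first exact: cmeasurable_cis_dotp.
have [k1 k2] := mk; have [m1 m2] := mm j.
apply: cmeasurableM; split.
- exact: (measurableT_comp k1 measurable_snd).
- exact: (measurableT_comp k2 measurable_snd).
- exact: (measurableT_comp m1 measurable_snd).
- exact: (measurableT_comp m2 measurable_snd).
Qed.

Lemma cnorm_le_sum (v : 'rV[R[i]]_l) : cnorm v <= \sum_j normc (v 0 j).
Proof.
have s0 (s : seq 'I_l) : 0 <= \sum_(j <- s) normc (v 0 j).
  by apply: sumr_ge0 => j _; exact: normc_ge0.
rewrite /cnorm -(ger0_norm (s0 _)) -sqrtr_sqr ler_wsqrtr//.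
elim: (index_enum _) => [|j s IH]; first by rewrite !big_nil sqr_ge0.
have nE : normc (v 0 j) ^+ 2 = complex.Re (v 0 j) ^+ 2 + complex.Im (v 0 j) ^+ 2.
  by rewrite normcE sqr_sqrtr// addr_ge0 ?sqr_ge0.
rewrite !big_cons sqrrD nE -[leRHS]addrA lerD2l.
apply: le_trans IH _; rewrite lerDr mulrn_wge0//.
by rewrite mulr_ge0 ?normc_ge0.
Qed.

(** Minkowski's inequality, one coordinate at a time: sqrt(a^2 + s^2) is the modulus
    of a + i s, so that each step is the triangle inequality in C. *)
Lemma sqrt_sum_triangle (I : Type) (s : seq I) (a b c : I -> R) :
  (forall i, 0 <= a i) -> (forall i, 0 <= b i) -> (forall i, 0 <= c i <= a i + b i) ->
  Num.sqrt (\sum_(i <- s) c i ^+ 2) <=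
  Num.sqrt (\sum_(i <- s) a i ^+ 2) + Num.sqrt (\sum_(i <- s) b i ^+ 2).
Proof.
move=> a0 b0 cab; elim: s => [|i s IH]; first by rewrite !big_nil sqrtr0 addr0.
rewrite !big_cons.
pose S (f : I -> R) := \sum_(i <- s) f i ^+ 2.
have S0 f : 0 <= S f by apply: sumr_ge0 => j _; exact: sqr_ge0.
have sE (f : I -> R) : Num.sqrt (f i ^+ 2 + S f) = normc (f i +i* Num.sqrt (S f)).
  by rewrite normcE/= sqr_sqrtr.
rewrite -/(S c) -/(S a) -/(S b) !sE; apply: le_trans (le_normcD _ _).
rewrite !normcE/= ler_wsqrtr//; have /andP[ci0 ciab] := cab i.
apply: lerD; rewrite lerXn2r// ?nnegrE//.
by rewrite addr_ge0.
Qed.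

Lemma cnorm_triangle (u v : 'rV[R[i]]_l) : cnorm (u + v) <= cnorm u + cnorm v.
Proof.
have E (w : 'rV[R[i]]_l) : cnorm w = Num.sqrt (\sum_j normc (w 0 j) ^+ 2).
  rewrite /cnorm; congr Num.sqrt; apply: eq_bigr => j _.
  by rewrite normcE sqr_sqrtr// addr_ge0 ?sqr_ge0.
rewrite !E; apply: sqrt_sum_triangle => j; try exact: normc_ge0.
by rewrite normc_ge0 mxE le_normcD.
Qed.

(** The difference of the two pieces has the symbol of the first one multiplied by
    1 - w N, which is O(1/N) on the bounded support of the multiplier; its sup norm
    is bounded by the integral of the symbol. *)
Lemma riesz_piece_approx (A : R) psi alpha k m (w : nat -> 'rV[R]_n -> R[i])
    (C : R -> R) : 1 < A -> 0 <= alpha -> besov_kernel psi ->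
  (forall j, cmeasurable (fun xi => m xi 0 j)) ->
  (forall j, exists M, forall xi, normc (m xi 0 j) <= M) ->
  (forall N, cmeasurable (w N)) ->
  (forall rho N xi, cube rho xi -> normc (w N xi - 1) <= C rho / N.+1%:R) ->
  exists K, forall N x,
    cnorm (distribution_conv (riesz alpha m) (besov_piece A psi k) x -
      distribution_conv (riesz alpha (fun xi => w N xi *: m xi)) (besov_piece A psi k) x)
    <= K / N.+1%:R.
Proof.
move=> A1 al0 kpsi mm bm mw wC; have A0 : 0 < A by rewrite (lt_trans ltr01).
have [spsi _ _] := kpsi.
have [mk [B [rho [B0 rho0 Bk]]]] := besov_multiplier_band k A1 al0 kpsi.
have /choice[M HM] := bm.
have kM0 j : 0 <= M j by apply: le_trans (HM j 0); exact: normc_ge0.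
pose V := \int[lambda]_xi \1_(cube rho : set 'rV[R]_n) xi.
have icube (c : R) : lambda.-integrable setT
    (EFin \o (fun xi => c * \1_(cube rho : set 'rV[R]_n) xi)).
  apply: (eq_integrable measurableT _ _ _ (integrableZl measurableT c
    (integrable_indic_cube rho0))).
  by move=> xi _; rewrite /= EFinM.
exists (\sum_j 2 * (B * M j * C rho * V)) => N x.
rewrite (le_trans (cnorm_le_sum _))// mulr_suml; apply: ler_sum => j _.
rewrite mxE [X in _ + X]mxE !riesz_pieceE//.
pose q xi := besov_multiplier A psi alpha k xi * m xi 0 j.
have mq : cmeasurable q by exact: cmeasurableM.
have qb xi : normc (q xi) <= (B * M j) * \1_(cube rho : set 'rV[R]_n) xi.
  rewrite /q normcM mulrAC; apply: ler_pM; rewrite ?normc_ge0//.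
have iq : cintegrable lambda q by exact: (le_cintegrable mq qb).
pose c := C rho / N.+1%:R * (B * M j).
have mwq : cmeasurable (fun xi => (w N xi - 1) * q xi).
  exact: cmeasurableM (cmeasurableD (mw N) (cmeasurable_cst (-1))) mq.
have wqb xi : normc ((w N xi - 1) * q xi) <= c * \1_(cube rho : set 'rV[R]_n) xi.
  have := qb xi; rewrite !indicE [normc ((_ - _) * _)]normcM.
  have [xic|nxic] := pselect (cube rho xi).
    rewrite mem_set// !mulr1 => qbxi.
    by rewrite /c; apply: ler_pM => //; [exact: normc_ge0|exact: normc_ge0|exact: wC].
  rewrite memNset// !mulr0 => q0.
  have -> : normc (q xi) = 0 by apply: le_anti; rewrite q0 normc_ge0.
  by rewrite mulr0.
have iwq : cintegrable lambda (fun xi => (w N xi - 1) * q xi).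
  exact: (le_cintegrable mwq wqb).
have iq' := cintegrable_cisM (2 * pi) x iq.
have iwq' := cintegrable_cisM (2 * pi) x iwq.
rewrite [X in _ - X](_ : _ = cintegral lambda (fun xi => cis (2 * pi * dotp x xi) * q xi) +
    cintegral lambda (fun xi => cis (2 * pi * dotp x xi) * ((w N xi - 1) * q xi))); last first.
  by rewrite -cintegralD//; apply: eq_cintegral => xi; rewrite mxE /q; ring.
rewrite opprD addNKr normcN.
apply: (@le_trans _ _ (2 * \int[lambda]_xi (c * \1_(cube rho : set 'rV[R]_n) xi))).
  apply: normc_cintegral_le => //; first exact: cintegrable_cmeasurable iwq'.
  by move=> xi; rewrite normcM normc_cis mul1r.
rewrite RintegralZl//; last exact: integrable_indic_cube.
rewrite -/V le_eqVlt; apply/orP; left; apply/eqP; rewrite /c; ring.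
Qed.

End riesz_pieces.

(** * Lower semicontinuity of Besov-Lorentz norms *)

Section lorentz.
Context {R : realType} {n l : nat}.
Local Notation lambda := (lebesgue_rV R n).
Local Notation mu := (@lebesgue_measure R).
Implicit Types h : 'rV[R]_n -> 'rV[R[i]]_l.

Lemma nonincreasing_emeasurable (f : R -> \bar R) :
  (forall s t, s <= t -> (f t <= f s)%E) ->
  measurable_fun [set: measurableTypeR R] f.
Proof.
move=> f_ni; apply: (measurability _ (ErealGenCInfty.measurableE R)).
move=> _ [_ [r ->] <-]; rewrite setTI; apply: is_interval_measurable => s t /=.
rewrite !in_itv/= !andbT => fs ft u /andP[su ut].
by rewrite in_itv/= andbT (le_trans ft)// f_ni.
Qed.

Definition lorentz_density (p : R) h (t : R) : \bar R :=
  (lambda [set x | t <= cnorm (h x)]%R `^ p^-1)%E.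

Lemma lorentz_density_ge0 p h t : (0 <= lorentz_density p h t)%E.
Proof. exact: poweR_ge0. Qed.

Lemma measurable_superlevel h t : measurable_fun setT (fun x => cnorm (h x)) ->
  measurable [set x | t <= cnorm (h x)].
Proof.
move=> mh; have := mh measurableT `[t, +oo[%classic (measurable_itv _).
by rewrite setTI; congr measurable; apply/seteqP; split => x /=; rewrite in_itv/= andbT.
Qed.

Lemma le_lorentz_density p h h' s t : 0 < p ->
  measurable_fun setT (fun x => cnorm (h x)) ->
  measurable_fun setT (fun x => cnorm (h' x)) ->
  (forall x, s <= cnorm (h x) -> t <= cnorm (h' x)) ->
  (lorentz_density p h s <= lorentz_density p h' t)%E.
Proof.
move=> p0 mh mh' hh'; apply: gt0_ler_poweR; rewrite ?invr_ge0 ?(ltW p0)//.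
- by rewrite in_itv/= leey andbT.
- by rewrite in_itv/= leey andbT.
- by apply: le_measure; rewrite ?inE; [exact: measurable_superlevel|
    exact: measurable_superlevel|move=> x /=; exact: hh'].
Qed.

Lemma measurable_lorentz_density p h : 0 < p ->
  measurable_fun setT (fun x => cnorm (h x)) ->
  measurable_fun [set: measurableTypeR R] (lorentz_density p h).
Proof.
move=> p0 mh; apply: nonincreasing_emeasurable => s t st.
by apply: le_lorentz_density => // x; exact: le_trans.
Qed.

(** The superlevel set of h at t + eps is contained in that of h' at t; the shift by
    eps is absorbed by a translation in t. *)
Lemma integral_lorentz_density_shift p h h' eps : 0 < p ->
  measurable_fun setT (fun x => cnorm (h x)) ->
  measurable_fun setT (fun x => cnorm (h' x)) ->
  (forall x, cnorm (h x) <= cnorm (h' x) + eps) ->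
  (\int[mu]_(t in `]eps, +oo[) lorentz_density p h t <=
   \int[mu]_(t in `]0%R, +oo[) lorentz_density p h' t)%E.
Proof.
move=> p0 mh mh' hh'.
have md := measurable_lorentz_density p0 mh.
have md' := measurable_lorentz_density p0 mh'.
rewrite integral_mkcond [leRHS]integral_mkcond.
rewrite -(@ge0_integral_affine1 _ 1 eps (_ \_ `]eps, +oo[)%E)//; last 2 first.
- by apply/(measurable_restrictT _ (measurable_itv _)); exact: measurable_funTS.
- by move=> t; rewrite patchE; case: ifP => // _; exact: lorentz_density_ge0.
rewrite normr1 mule1; apply: ge0_le_integral => //.
- by move=> t _; rewrite patchE; case: ifP => // _; exact: lorentz_density_ge0.
- have := @measurable_affine1 R 1 eps.
  apply: (@measurableT_comp _ _ _ _ _ _ (lorentz_density p h \_ `]eps, +oo[)).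
  by apply/(measurable_restrictT _ (measurable_itv _)); exact: measurable_funTS.
- by apply/(measurable_restrictT _ (measurable_itv _)); exact: measurable_funTS.
move=> t _; rewrite mul1r !patchE !mem_setE !in_itv/= !andbT ltrDr.
case: ifP => // t0; apply: le_lorentz_density => // x tx.
by rewrite -(lerD2r eps) (le_trans tx).
Qed.

Lemma ge0_integral_itv0oy_le (f : R -> \bar R) (V : \bar R) :
  measurable_fun [set: measurableTypeR R] f -> (forall t, (0 <= f t)%E) ->
  (forall eps : R, 0 < eps -> (\int[mu]_(t in `]eps, +oo[) f t <= V)%E) ->
  (\int[mu]_(t in `]0%R, +oo[) f t <= V)%E.
Proof.
move=> mf f0 fV.
pose F (i : nat) : set (measurableTypeR R) := `]i.+1%:R^-1, +oo[%classic.
have -> : `]0%R, +oo[%classic = \bigcup_i F i.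
  apply/seteqP; split => t; last first.
    by move=> [i _]; rewrite /F/= !in_itv/= !andbT; apply: lt_trans.
  rewrite /= in_itv/= andbT => t0; have [N tN] := ltr_add_invr t0.
  by move: tN; rewrite add0r => tN; exists N => //; rewrite /F/= in_itv/= andbT.
have cv : (fun i => \int[mu]_(x in F i) f x)%E @ \oo --> (\int[mu]_(x in \bigcup_i F i) f x)%E.
  apply: ge0_nondecreasing_set_cvg_integral => //.
  - move=> i j ij; apply/subsetPset => u /=; rewrite /F/= !in_itv/= !andbT.
    by apply: le_lt_trans; rewrite lef_pV2 ?posrE// ler_nat.
  - by move=> i; exact: measurable_itv.
  - by move=> i; exact: measurable_funTS.
rewrite -(cvg_lim _ cv)//; apply: lime_le; first by apply/cvg_ex; eexists; exact: cv.
by apply: nearW => i; apply: fV.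
Qed.

End lorentz.

Section lower_semicontinuity.
Context {R : realType} {n l : nat}.
Local Notation lambda := (lebesgue_rV R n).
Local Notation mu := (@lebesgue_measure R).

(** Lower semicontinuity of the sum over k of Lorentz norms under uniform
    convergence of each term, at a rate that may depend on k. *)
Lemma lorentz_sum_lsc (I : choiceType) (p : R) (V : \bar R)
    (h : I -> 'rV[R]_n -> 'rV[R[i]]_l) (hN : nat -> I -> 'rV[R]_n -> 'rV[R[i]]_l) :
  0 < p ->
  (forall k, measurable_fun setT (fun x => cnorm (h k x))) ->
  (forall N k, measurable_fun setT (fun x => cnorm (hN N k x))) ->
  (forall k, exists K, forall N x, cnorm (h k x - hN N k x) <= K / N.+1%:R) ->
  (forall N, (\esum_(k in [set: I]) lorentz_norm p (hN N k) <= V)%E) ->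
  (\esum_(k in [set: I]) lorentz_norm p (h k) <= V)%E.
Proof.
move=> p0 mh mhN /choice[K HK] HV.
apply: ge_ereal_sup => _ [F [fF _] <-].
rewrite fsbig_finite//=; set s := finmap.enum_fset _.
have pE : (0 <= p%:E)%E by rewrite lee_fin ltW.
have dm k := measurable_lorentz_density p0 (mh k).
have lE (g : 'rV[R]_n -> 'rV[R[i]]_l) : lorentz_norm p g =
  (p%:E * \int[mu]_(t in `]0%R, +oo[) lorentz_density p g t)%E by [].
have mpd k (D : set (measurableTypeR R)) :
    measurable_fun D (fun t => p%:E * lorentz_density p (h k) t)%E.
  by apply: measurable_funeM; exact: measurable_funTS.
have pd0 k t : (0 <= p%:E * lorentz_density p (h k) t)%E.
  by rewrite mule_ge0// lorentz_density_ge0.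
have sumE (D : set (measurableTypeR R)) : measurable D ->
  (\sum_(k <- s) p%:E * \int[mu]_(t in D) lorentz_density p (h k) t =
   \int[mu]_(t in D) \sum_(k <- s) p%:E * lorentz_density p (h k) t)%E.
  move=> mD; rewrite ge0_integral_sum//; apply: eq_bigr => k _.
  rewrite ge0_integralZl//; first exact: measurable_funTS.
  by move=> t _; exact: lorentz_density_ge0.
under eq_bigr do rewrite lE.
rewrite sumE; last exact: measurable_itv.
apply: ge0_integral_itv0oy_le.
- by apply: emeasurable_sum => k; exact: mpd.
- by move=> t; apply: sume_ge0.
move=> eps eps0; rewrite -sumE; last exact: measurable_itv.
pose S := \sum_(k <- s) `|K k|.
(* S bounds all the constants K k of the finite sum, so that K k / N.+1 <= eps. *)
pose N := Num.truncn (S / eps).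
have NS : S / N.+1%:R <= eps.
  rewrite ler_pdivrMr// mulrC -ler_pdivrMr//; exact/ltW/truncnS_gt.
apply: le_trans (HV N).
apply: (@le_trans _ _ (\sum_(k <- s) lorentz_norm p (hN N k))%E); last first.
  by apply: ereal_sup_ubound; exists F; [split|rewrite fsbig_finite].
rewrite big_seq [leRHS]big_seq; apply: lee_sum => k kF.
rewrite lE; apply: lee_wpmul2l => //; apply: integral_lorentz_density_shift => // x.
rewrite -[X in cnorm X](subrK (hN N k x)) addrC (le_trans (cnorm_triangle _ _))//.
rewrite lerD2l (le_trans (HK k N x))// (le_trans _ NS)// ler_pM2r ?invr_gt0//.
rewrite (le_trans (ler_norm _))// /S (perm_big _ (perm_to_rem kF))/= big_cons lerDl.
by apply: sumr_ge0.
Qed.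

End lower_semicontinuity.

(** * From W_1 to BV *)

Theorem corollary1p12 (R : realType) (d l k : nat)
  (hk : (1 <= k)%N) (hkl : (k <= l)%N) (hd : (1 <= d)%N)
  (A : R) (hA : 1 < A) (psi : 'rV[R]_d -> R[i]) (hpsi : besov_kernel psi)
  (HW : forall Omega : 'rV[R]_d -> {vspace 'rV[R[i]]_l},
    grassmann_valued k Omega -> grassmann_smooth k Omega ->
    trivial_intersection Omega ->
    forall alpha : R, 0 < alpha < d%:R ->
    exists C : R, forall f : 'rV[R]_d -> 'rV[R[i]]_l, W1_space Omega f ->
      (besov_lorentz_norm A psi (d%:R / (d%:R - alpha)) (riesz alpha (vfourier f))
         <= C%:E * L1_norm f)%E) :
  forall Omega : 'rV[R]_d -> {vspace 'rV[R[i]]_l},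
    grassmann_valued k Omega -> grassmann_smooth k Omega ->
    trivial_intersection Omega ->
    forall alpha : R, 0 < alpha < d%:R ->
    exists C : R, forall mu : vcharge R 'rV[R]_d l, BV_space Omega mu ->
      (besov_lorentz_norm A psi (d%:R / (d%:R - alpha))
         (riesz alpha (charge_fourier mu)) <= C%:E * vcharge_variation mu)%E.
Proof.
move=> Omega Og Os Ot alpha alphad; have /andP[alpha0 alphaltd] := alphad.
have [C HC] := HW Omega Og Os Ot alpha alphad.
have A0 : 0 < A by rewrite (lt_trans ltr01).
have [spsi _ _] := hpsi.
(* C could be negative, and inequalities are multiplied by the constant below. *)
exists (Num.max C 0) => mu [_ muO].
have p0 : 0 < d%:R / (d%:R - alpha).
  by rewrite divr_gt0 ?ltr0n// subr_gt0.
have vfE N : vfourier (mollify N mu) =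
    (fun xi => cell_weight N xi *: charge_fourier mu xi).
  by apply/funext => xi; exact: vfourier_mollify.
have mw N : cmeasurable (@cell_weight R d N).
  apply: cmeasurableM; first exact: cmeasurable_cst.
  apply: cmeasurable_fourier; apply: cmeasurable_real.
  exact: measurable_indic_cell.
have mF j := (charge_fourier_bounded mu j).1.
have bF j := (charge_fourier_bounded mu j).2.
have mk k := (besov_multiplier_band k hA (ltW alpha0) hpsi).1.
have /choice[w Hw] := @cell_weightB1 R d.
apply: (@lorentz_sum_lsc R d l int _ _
  (fun k => distribution_conv (riesz alpha (charge_fourier mu)) (besov_piece A psi k))
  (fun N k => distribution_conv (riesz alpha (vfourier (mollify N mu)))
     (besov_piece A psi k))) => //.
- by move=> k'; exact: measurable_riesz_piece.
- move=> N k'; rewrite vfE; apply: measurable_riesz_piece => // j.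
  under [X in cmeasurable X]eq_fun do rewrite mxE.
  exact: cmeasurableM.
- move=> k'.
  have [K HK] := riesz_piece_approx k' hA (ltW alpha0) hpsi mF bF mw Hw.
  by exists K => N x; rewrite vfE; exact: HK.
- move=> N; apply: le_trans (HC (mollify N mu) _) _.
    split; first exact: L1_mollify.
    by move=> xi xi0; rewrite vfourier_mollify memvZ// muO.
  apply: (@le_trans _ _ ((Num.max C 0)%:E * L1_norm (mollify N mu))%E).
    apply: lee_wpmul2r; last by rewrite lee_fin le_max lexx.
    by apply: integral_ge0 => x _; rewrite lee_fin cnorm_ge0.
  apply: lee_wpmul2l; first by rewrite lee_fin le_max lexx orbT.
  exact: L1_norm_mollify.
Qed.
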